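(* Let $f$ be the generator of a continuous one-parameter semigroup of holomorphic self-mappings of the open unit disk $\mathbb{D}$ with the Denjoy-Wolff point $a=1$. Suppose $\zeta_1,\dots,\zeta_N\in\partial\mathbb{D}$ are pairwise distinct boundary regular null points of $f$ different from $a$, with $f'(\zeta_n)<0$. Then for all $z\in\mathbb{D}$ $$C\,l(z)\le\Big|\frac1{f(z)}-\sum_{n=1}^N\frac1{g_n(z)}-\frac{ic}{(z-1)^2}\Big|\le C\,u(z),$$ where $$\frac1{g_n(z)}=\frac1{|f'(\zeta_n)|}\Big(\frac1{z-1}-\frac1{z-\zeta_n}\Big)$$ and $$c=\operatorname{Im}\Big(\frac1{f(0)}\Big)+\sum_{n=1}^N\frac{\operatorname{Im}\zeta_n}{|f'(\zeta_n)|},\qquad C=-\operatorname{Re}\Big(\frac1{f(0)}\Big)-\sum_{n=1}^N\frac{1-\operatorname{Re}\zeta_n}{|f'(\zeta_n)|},$$ $$u(z)=\frac{1+|z|}{1-|z|}\,\frac1{|1-z|^2},\qquad l(z)=\frac{1-|z|}{1+|z|}\,\frac1{|1-z|^2}.$$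
   Context: $\mathbb{D}$ is the open unit disk in $\mathbb{C}$. A (continuous one-parameter) semigroup on $\mathbb{D}$ is a family $\{F_t\}_{t\ge0}$ of holomorphic self-mappings of $\mathbb{D}$ with $F_{s+t}=F_s\circ F_t$, $F_0(z)=z$, continuous in $t$. Its (infinitesimal) generator is the holomorphic function $f(z)=\lim_{t\to0^+}\frac1t(z-F_t(z))$ on $\mathbb{D}$. For a semigroup that is nontrivial and contains no elliptic automorphisms of $\mathbb{D}$, the Denjoy-Wolff point is the unique $a\in\overline{\mathbb{D}}$ with $F_t(z)\to a$ as $t\to\infty$ for all $z\in\mathbb{D}$. For $\zeta\in\partial\mathbb{D}$, $f(\zeta)$ denotes the angular (nontangential) limit of $f$ at $\zeta$, and, when this is $0$, $f'(\zeta)=\angle\lim_{z\to\zeta}\frac{f(z)}{z-\zeta}$ is the angular derivative. A boundary regular null point of $f$ is a point $\zeta\in\partial\mathbb{D}$ at which the angular limit of $f$ exists and equals $0$ and the angular derivative exists and is finite. *)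

(* Defs.v *)
From Stdlib Require Import Reals.
From Coquelicot Require Import Coquelicot.

Open Scope R_scope.

Definition in_disk (z : C) : Prop := Cmod z < 1.

Definition on_circle (z : C) : Prop := Cmod z = 1.

(* Functions on the disk are total functions [C -> C] of which only the values
   on the (open) disk matter. Differentiability is over the field of complex
   numbers. *)
Definition holomorphic_on_disk (f : C -> C) : Prop :=
  forall z : C, in_disk z -> @ex_derive C_AbsRing C_NormedModule f z.

(* [F t] is only meaningful for [0 <= t]. Continuity in [t] is required
   pointwise on the disk, one-sided at [t = 0]. *)
Record is_semigroup (F : R -> C -> C) : Prop := {
  semigroup_holo : forall t, 0 <= t -> holomorphic_on_disk (F t);
  semigroup_self : forall t z, 0 <= t -> in_disk z -> in_disk (F t z);
  semigroup_add : forall s t z, 0 <= s -> 0 <= t -> in_disk z ->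
    F (s + t) z = F s (F t z);
  semigroup_zero : forall z, in_disk z -> F 0 z = z;
  semigroup_cont : forall z t, in_disk z -> 0 <= t ->
    filterlim (fun s => F s z)
      (within (fun s => 0 <= s) (locally t)) (locally (F t z))
}.

Definition is_generator (F : R -> C -> C) (f : C -> C) : Prop :=
  holomorphic_on_disk f /\
  forall z : C, in_disk z ->
    filterlim (fun t : R => (RtoC (/ t) * (z - F t z))%C)
      (at_right 0) (locally (f z)).

(* Uniqueness of [a] is automatic (limits are unique). The identity semigroup
   and semigroups containing an elliptic automorphism of the disk are excluded
   by the convergence requirement itself: the former fixes every point, and in
   the latter every orbit of points other than the fixed point fails to
   converge to it. *)
Definition is_Denjoy_Wolff_point (F : R -> C -> C) (a : C) : Prop :=
  Cmod a <= 1 /\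
  forall z : C, in_disk z ->
    filterlim (fun t : R => F t z) (Rbar_locally p_infty) (locally a).

(* Nontangential approach region (Stolz region) of aperture [M] at [zeta]. *)
Definition Stolz (zeta : C) (M : R) (z : C) : Prop :=
  in_disk z /\ Cmod (z - zeta) < M * (1 - Cmod z).

Definition is_angular_lim (f : C -> C) (zeta l : C) : Prop :=
  forall M : R, 1 < M ->
    filterlim f (within (Stolz zeta M) (locally zeta)) (locally l).

(* Used only where the angular limit of [f] at [zeta] is [0]. *)
Definition is_angular_derivative (f : C -> C) (zeta l : C) : Prop :=
  is_angular_lim (fun z => (f z / (z - zeta))%C) zeta l.

Definition boundary_regular_null_point (f : C -> C) (zeta : C) : Prop :=
  on_circle zeta /\ is_angular_lim f zeta (RtoC 0) /\
  exists l : C, is_angular_derivative f zeta l.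

(* [1 / g_n], where [d] is the angular derivative of [f] at [zeta]. *)
Definition inv_g (zeta : C) (d : R) (z : C) : C :=
  (RtoC (/ Rabs d) * (/ (z - 1) - / (z - zeta)))%C.

(* [sum_n_m a 1 N] is the sum of [a n] over [1 <= n <= N], and is [0] when
   [N = 0]. *)
Definition const_c (f : C -> C) (N : nat) (zeta : nat -> C) (d : nat -> R) : R :=
  Im (/ f (RtoC 0))%C + sum_n_m (fun n => Im (zeta n) / Rabs (d n)) 1 N.

Definition const_C (f : C -> C) (N : nat) (zeta : nat -> C) (d : nat -> R) : R :=
  - Re (/ f (RtoC 0))%C - sum_n_m (fun n => (1 - Re (zeta n)) / Rabs (d n)) 1 N.

Definition upper_u (z : C) : R :=
  (1 + Cmod z) / (1 - Cmod z) * (1 / (Cmod (1 - z)) ^ 2).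

Definition lower_l (z : C) : R :=
  (1 - Cmod z) / (1 + Cmod z) * (1 / (Cmod (1 - z)) ^ 2).

(* Main.v *)
Require Import Defs.
From Stdlib Require Import Reals.
From Coquelicot Require Import Coquelicot.
From Stdlib Require Import Lra Lia ClassicalEpsilon.

Open Scope R_scope.

(** By Julia's lemma at the Denjoy-Wolff point 1 the semigroup preserves
    horocycles, and differentiating at [t = 0] gives
    [Re (- (1 - z)^2 / f z) >= 0] on the disk. A boundary regular null point
    [zeta] contributes to the Herglotz measure of this function an atom of mass
    [(1 - Re zeta) / |f' zeta|], whose kernel is [- (1 - z)^2 / g_n z]. Subtracting
    the atoms one at a time (Julia's lemma at [zeta]) leaves a function [h] with
    nonnegative real part, and the Schwarz-Pick inequality for [h] between [0] and
    [z] bounds [|h z - i Im (h 0)|] on both sides in terms of [Re (h 0) = C].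
    The function theory rests on Goursat's bisection argument, which yields the
    mean value property and thence the maximum principle. *)

(** * Complex derivatives *)

(** No Herglotz measure is ever constructed. An atom of mass m of a function q at zeta enters only
    through the radial limit of (1 - r) q(r zeta), which is 2m. A kernel removed at one point is
    regular at the other points, so it does not disturb their limits; this is what turns the
    subtraction into an induction. The Pick inequality is kept in product form, without
    denominators, so that it tolerates real part zero and survives limits toward the circle.

    The constants of the theorem are values at the origin: Re h(0) = C and Im h(0) = -c, where
    1/zeta = conj zeta produces the terms in Re zeta and Im zeta. Then h(z) + ic is -(1 - z)^2 times
    the expression to be estimated, and division by |1 - z|^2 turns the Harnack factors (1 + |z|)/(1
    - |z|) and its inverse into u and l.

    Before 1/f can be handled, f must be shown to have no zero: one zero would make f vanish
    identically, the orbit of 0 would then stand still, and it could not converge to 1. *)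

Notation cdiff := (@ex_derive C_AbsRing C_NormedModule).

Lemma is_derive_C_eps (f : C -> C) (z l : C) :
  @is_derive C_AbsRing C_NormedModule f z l <->
  forall eps : R, 0 < eps -> exists delta : R, 0 < delta /\
    forall w : C, Cmod (w - z) < delta ->
      Cmod (f w - f z - (w - z) * l) <= eps * Cmod (w - z).
Proof.
split.
- intros [_ H] eps He.
  destruct (H z (fun P HP => HP) (mkposreal eps He)) as [d Hd].
  exists d; split; [apply cond_pos|].
  intros w Hw; exact (Hd w Hw).
- intros H; split.
  + apply is_linear_scal_l.
  + intros x Hx eps.
    assert (E := @is_filter_lim_locally_unique C_AbsRing
      (AbsRing_NormedModule C_AbsRing) z x Hx); rewrite <- E; clear x Hx E.
    destruct (H eps (cond_pos eps)) as [d [Hd H1]].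
    exists (mkposreal d Hd); intros w Hw; exact (H1 w Hw).
Qed.

(** [C] carries two normed-module structures over itself. The product and chain rules speak of the
    one coming from the ring, [holomorphic_on_disk] of the other; the remainder estimates are the
    same. *)
Lemma is_derive_C_absring (f : C -> C) (z l : C) :
  @is_derive C_AbsRing (AbsRing_NormedModule C_AbsRing) f z l <->
  @is_derive C_AbsRing C_NormedModule f z l.
Proof.
split; intros [_ H]; (split; [apply is_linear_scal_l|exact H]).
Qed.

Lemma cdiff_continuous (f : C -> C) (z : C) :
  cdiff f z -> forall eps : R, 0 < eps -> exists delta : R, 0 < delta /\
    forall w : C, Cmod (w - z) < delta -> Cmod (f w - f z) < eps.
Proof.
intros [l Hl] eps He.
destruct (proj1 (is_derive_C_eps f z l) Hl 1 Rlt_0_1) as [d [Hd H]].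
assert (HM : 0 < 1 + Cmod l) by (generalize (Cmod_ge_0 l); lra).
exists (Rmin d (eps / (1 + Cmod l))); split.
- apply Rmin_glb_lt; [exact Hd|]. apply Rdiv_lt_0_compat; assumption.
- intros w Hw.
  assert (H1 := H w (Rlt_le_trans _ _ _ Hw (Rmin_l _ _))).
  assert (H2 := Rlt_le_trans _ _ _ Hw (Rmin_r _ _)).
  replace (f w - f z)%C with ((f w - f z - (w - z) * l) + (w - z) * l)%C by ring.
  eapply Rle_lt_trans; [apply Cmod_triangle|]. rewrite Cmod_mult.
  apply (Rmult_lt_compat_r _ _ _ HM) in H2.
  unfold Rdiv in H2; rewrite Rmult_assoc, Rinv_l, Rmult_1_r in H2 by lra. lra.
Qed.

Lemma cdiff_ext (f g : C -> C) (z : C) (delta : R) :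
  0 < delta -> (forall w, Cmod (w - z) < delta -> f w = g w) ->
  cdiff f z -> cdiff g z.
Proof.
intros Hd H [l Hl]; exists l.
apply is_derive_C_eps; intros eps He.
destruct (proj1 (is_derive_C_eps f z l) Hl eps He) as [d [Hd' H']].
exists (Rmin d delta); split; [apply Rmin_glb_lt; assumption|].
intros w Hw.
rewrite <- (H w) by (eapply Rlt_le_trans; [exact Hw|apply Rmin_r]).
rewrite <- (H z).
- apply H'; eapply Rlt_le_trans; [exact Hw|apply Rmin_l].
- replace (z - z)%C with (RtoC 0) by ring. rewrite Cmod_0; exact Hd.
Qed.

Lemma cdiff_const (c z : C) : cdiff (fun _ => c) z.
Proof. exact (ex_derive_const c z). Qed.

Lemma cdiff_id (z : C) : cdiff (fun w => w) z.
Proof.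
exists (RtoC 1); apply is_derive_C_eps; intros eps He; exists 1; split; [lra|].
intros w _; replace (w - z - (w - z) * 1)%C with (RtoC 0) by ring.
rewrite Cmod_0; apply Rmult_le_pos; [lra|apply Cmod_ge_0].
Qed.

Lemma cdiff_plus (f g : C -> C) (z : C) :
  cdiff f z -> cdiff g z -> cdiff (fun w => f w + g w)%C z.
Proof. exact (ex_derive_plus f g z). Qed.

Lemma cdiff_minus (f g : C -> C) (z : C) :
  cdiff f z -> cdiff g z -> cdiff (fun w => f w - g w)%C z.
Proof. exact (ex_derive_minus f g z). Qed.

Lemma cdiff_opp (f : C -> C) (z : C) : cdiff f z -> cdiff (fun w => - f w)%C z.
Proof. exact (ex_derive_opp f z). Qed.

Lemma cdiff_mult (f g : C -> C) (z : C) :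
  cdiff f z -> cdiff g z -> cdiff (fun w => f w * g w)%C z.
Proof.
intros [l Hl] [m Hm]; eexists; apply is_derive_C_absring.
apply is_derive_C_absring in Hl; apply is_derive_C_absring in Hm.
exact (is_derive_mult f g z l m Hl Hm Cmult_comm).
Qed.

Lemma cdiff_comp (f g : C -> C) (z : C) :
  cdiff f (g z) -> cdiff g z -> cdiff (fun w => f (g w)) z.
Proof.
intros [l Hl] [m Hm]; eexists.
apply is_derive_C_absring in Hm; exact (is_derive_comp f g z l m Hl Hm).
Qed.

Lemma cdiff_pow (f : C -> C) (z : C) (n : nat) :
  cdiff f z -> cdiff (fun w => f w ^ n)%C z.
Proof.
intros H; induction n as [|n IH]; [exact (cdiff_const (RtoC 1) z)|].
exact (cdiff_mult f (fun w => f w ^ n)%C z H IH).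
Qed.

Lemma cdiff_inv_id (z : C) : z <> RtoC 0 -> cdiff Cinv z.
Proof.
intros Hz; exists (- / (z * z))%C.
apply is_derive_C_eps; intros eps He.
assert (Hm : 0 < Cmod z) by (apply Cmod_gt_0; exact Hz).
assert (Hk : 0 < eps * Cmod z ^ 3 / 2)
  by (apply Rdiv_lt_0_compat; [apply Rmult_lt_0_compat; [|apply pow_lt]|]; lra).
(* The first-order remainder of 1/w is (w - z)^2 / (w z^2). The first bound gives |w| > |z|/2, the
   second then makes |w - z| / (|w| |z|^2) at most [eps]. *)
exists (Rmin (Cmod z / 2) (eps * Cmod z ^ 3 / 2)); split.
{ apply Rmin_glb_lt; lra. }
intros w Hw.
assert (H1 := Rlt_le_trans _ _ _ Hw (Rmin_l _ _)).
assert (H2 := Rlt_le_trans _ _ _ Hw (Rmin_r _ _)).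
assert (Hwm : Cmod z / 2 < Cmod w).
{ assert (H3 := Cmod_triangle w (- (w - z))).
  replace (w + - (w - z))%C with z in H3 by ring. rewrite Cmod_opp in H3. lra. }
assert (Hw0 : w <> RtoC 0) by (apply Cmod_gt_0; lra).
replace (/ w - / z - (w - z) * - / (z * z))%C
  with ((w - z) * (w - z) / (w * (z * z)))%C by (field; auto).
rewrite Cmod_div, !Cmod_mult by (repeat apply Cmult_neq_0; auto).
set (a := Cmod (w - z)) in *; set (m := Cmod z) in *; set (n := Cmod w) in *.
assert (Ha : 0 <= a) by apply Cmod_ge_0.
assert (Hp : 0 < n * (m * m)) by (repeat apply Rmult_lt_0_compat; lra).
apply (Rmult_le_reg_r (n * (m * m))); [exact Hp|].
unfold Rdiv; rewrite Rmult_assoc, Rinv_l, Rmult_1_r by lra.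
assert (a <= eps * (n * (m * m))); [|nra].
apply Rlt_le, (Rlt_trans _ _ _ H2).
replace (eps * m ^ 3 / 2) with (eps * (m / 2 * (m * m))) by field.
apply Rmult_lt_compat_l; [exact He|]. apply Rmult_lt_compat_r; nra.
Qed.

Lemma cdiff_inv (f : C -> C) (z : C) :
  f z <> RtoC 0 -> cdiff f z -> cdiff (fun w => / f w)%C z.
Proof. intros H0 H; apply (cdiff_comp Cinv f); [apply cdiff_inv_id|]; assumption. Qed.

Lemma cdiff_div (f g : C -> C) (z : C) :
  g z <> RtoC 0 -> cdiff f z -> cdiff g z -> cdiff (fun w => f w / g w)%C z.
Proof. intros H0 Hf Hg; apply cdiff_mult; [|apply cdiff_inv]; assumption. Qed.

Lemma one_minus_sqr_cdiff (z : C) : cdiff (fun w => (1 - w) * (1 - w))%C z.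
Proof.
apply cdiff_mult; apply cdiff_minus; [apply cdiff_const|apply cdiff_id|
  apply cdiff_const|apply cdiff_id].
Qed.

(** * Goursat's lemma in real form *)

Lemma nested_segments (lo hi : nat -> R) :
  (forall n, lo n <= lo (S n)) -> (forall n, hi (S n) <= hi n) ->
  (forall n, lo n <= hi n) -> exists x, forall n, lo n <= x <= hi n.
Proof.
intros Hlo Hhi Hlh.
assert (Mlo : forall n k, lo n <= lo (n + k)%nat).
{ intros n k; induction k as [|k IH]; [rewrite Nat.add_0_r; lra|].
  rewrite Nat.add_succ_r; eapply Rle_trans; [exact IH|apply Hlo]. }
assert (Mhi : forall n k, hi (n + k)%nat <= hi n).
{ intros n k; induction k as [|k IH]; [rewrite Nat.add_0_r; lra|].
  rewrite Nat.add_succ_r; eapply Rle_trans; [apply Hhi|exact IH]. }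
assert (Hx : forall n m, lo n <= hi m).
{ intros n m; apply Rle_trans with (lo (n + m)%nat); [apply Mlo|].
  apply Rle_trans with (hi (n + m)%nat); [apply Hlh|].
  rewrite Nat.add_comm; apply Mhi. }
destruct (completeness (fun r => exists n, r = lo n)) as [x [Hub Hlub]].
- exists (hi O); intros r [n ->]; apply Hx.
- exists (lo O), O; reflexivity.
- exists x; intros n; split.
  + apply Hub; exists n; reflexivity.
  + apply Hlub; intros r [m ->]; apply Hx.
Qed.

Lemma rectangle_bisection (A B x0 y0 : R) (Bad : nat -> R -> R -> Prop) :
  0 <= A -> 0 <= B -> Bad O x0 y0 ->
  (forall n x y,
     x0 <= x -> x + A / 2 ^ n <= x0 + A -> y0 <= y -> y + B / 2 ^ n <= y0 + B ->
     Bad n x y ->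
     exists x' y', (x' = x \/ x' = x + A / 2 ^ S n) /\
       (y' = y \/ y' = y + B / 2 ^ S n) /\ Bad (S n) x' y') ->
  exists xs ys, forall n, exists x y,
    Bad n x y /\ x <= xs <= x + A / 2 ^ n /\ y <= ys <= y + B / 2 ^ n /\
    x0 <= x /\ x + A / 2 ^ n <= x0 + A /\ y0 <= y /\ y + B / 2 ^ n <= y0 + B.
Proof.
intros HA HB H0 HS.
assert (Half : forall a n, a / 2 ^ S n + a / 2 ^ S n = a / 2 ^ n).
{ intros a n; simpl; field; apply pow_nonzero; lra. }
assert (Pos : forall a n, 0 <= a -> 0 <= a / 2 ^ n).
{ intros a n Ha; apply Rmult_le_pos; [exact Ha|].
  left; apply Rinv_0_lt_compat, pow_lt; lra. }
pose (In := fun n (p : R * R) =>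
  (x0 <= fst p /\ fst p + A / 2 ^ n <= x0 + A /\
   y0 <= snd p /\ snd p + B / 2 ^ n <= y0 + B) /\ Bad n (fst p) (snd p)).
pose (Sub := fun n (p q : R * R) =>
  fst p <= fst q /\ fst q + A / 2 ^ S n <= fst p + A / 2 ^ n /\
  snd p <= snd q /\ snd q + B / 2 ^ S n <= snd p + B / 2 ^ n).
(* The invariant [In n p] stands under the existential, so that choice gives a total function
   [next]; the invariant is recovered afterwards by induction along the sequence. *)
assert (Step : forall n p, exists q, In n p -> In (S n) q /\ Sub n p q).
{ intros n [x y].
  destruct (excluded_middle_informative (In n (x, y))) as [Hin|Hn];
    [|exists (x, y); tauto].
  destruct Hin as [[h1 [h2 [h3 h4]]] h5]; simpl in h1, h2, h3, h4, h5.
  destruct (HS n x y h1 h2 h3 h4 h5) as [x' [y' [hx [hy hb]]]].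
  exists (x', y'); intros _; unfold In, Sub; cbn [fst snd].
  generalize (Half A n) (Half B n) (Pos A (S n) HA) (Pos B (S n) HB); intros.
  repeat split; try assumption; destruct hx, hy; subst; lra. }
pose (next := fun n p => proj1_sig (constructive_indefinite_description _ (Step n p))).
pose (s := fix s n := match n with O => (x0, y0) | S m => next m (s m) end).
assert (Hs : forall n, In n (s n)).
{ intros n; induction n as [|n IH].
  - unfold In; cbn; repeat split; try lra; exact H0.
  - change (s (S n)) with (next n (s n)); unfold next.
    destruct (constructive_indefinite_description _ (Step n (s n))) as [q Hq].
    apply Hq, IH. }
assert (Hsub : forall n, Sub n (s n) (s (S n))).
{ intros n; change (s (S n)) with (next n (s n)); unfold next.
  destruct (constructive_indefinite_description _ (Step n (s n))) as [q Hq].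
  apply Hq, Hs. }
destruct (nested_segments (fun n => fst (s n)) (fun n => fst (s n) + A / 2 ^ n))
  as [xs Hxs].
{ intros n; apply (Hsub n). }
{ intros n; apply (Hsub n). }
{ intros n; generalize (Pos A n HA); lra. }
destruct (nested_segments (fun n => snd (s n)) (fun n => snd (s n) + B / 2 ^ n))
  as [ys Hys].
{ intros n; apply (Hsub n). }
{ intros n; apply (Hsub n). }
{ intros n; generalize (Pos B n HB); lra. }
exists xs, ys; intros n; exists (fst (s n)), (snd (s n)).
destruct (Hs n) as [? ?]; repeat split; try apply Hxs; try apply Hys; tauto.
Qed.

(** The line integral of P dx + Q dy, counterclockwise around the boundary of the rectangle [a,b] x
    [c,d]. *)
Definition circulation (P Q : R -> R -> R) (a b c d : R) : R :=
  RInt (fun x => P x c) a b + RInt (fun y => Q b y) c d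
  - RInt (fun x => P x d) a b - RInt (fun y => Q a y) c d.

(** The shared [p2] is the closedness condition dP/dy = dQ/dx. *)
Definition closed_form_on (P Q : R -> R -> R) (a b c d : R) : Prop :=
  forall x y, a <= x <= b -> c <= y <= d -> exists p1 p2 q2,
    differentiable_pt_lim P x y p1 p2 /\ differentiable_pt_lim Q x y p2 q2.

Lemma differentiable_pt_lim_continuous (f : R -> R -> R) (x y l1 l2 : R) :
  differentiable_pt_lim f x y l1 l2 ->
  continuous (fun u => f u y) x /\ continuous (fun v => f x v) y.
Proof.
intros H; split.
- apply (ex_derive_continuous (V := R_NormedModule) (fun u => f u y)).
  exists (l1 * 1 + l2 * 0); apply is_derive_Reals.
  apply (derivable_pt_lim_comp_2d f (fun u => u) (fun _ => y)); [exact H| |].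
  + apply derivable_pt_lim_id.
  + apply derivable_pt_lim_const.
- apply (ex_derive_continuous (V := R_NormedModule) (fun v => f x v)).
  exists (l1 * 0 + l2 * 1); apply is_derive_Reals.
  apply (derivable_pt_lim_comp_2d f (fun _ => x) (fun v => v)); [exact H| |].
  + apply derivable_pt_lim_const.
  + apply derivable_pt_lim_id.
Qed.

Lemma closed_form_ex_RInt (P Q : R -> R -> R) (a b c d : R) :
  closed_form_on P Q a b c d ->
  (forall y a' b', c <= y <= d -> a <= a' -> a' <= b' -> b' <= b ->
     ex_RInt (fun x => P x y) a' b') /\
  (forall x c' d', a <= x <= b -> c <= c' -> c' <= d' -> d' <= d ->
     ex_RInt (fun y => Q x y) c' d').
Proof.
intros H; split.
- intros y a' b' Hy h1 h2 h3; apply (ex_RInt_continuous (V := R_CompleteNormedModule)).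
  rewrite Rmin_left, Rmax_right by lra; intros x Hx.
  destruct (H x y) as [p1 [p2 [q2 [HP _]]]]; [lra|lra|].
  apply (differentiable_pt_lim_continuous _ _ _ _ _ HP).
- intros x c' d' Hx h1 h2 h3; apply (ex_RInt_continuous (V := R_CompleteNormedModule)).
  rewrite Rmin_left, Rmax_right by lra; intros y Hy.
  destruct (H x y) as [p1 [p2 [q2 [_ HQ]]]]; [lra|lra|].
  apply (differentiable_pt_lim_continuous _ _ _ _ _ HQ).
Qed.

Lemma RInt_difference_bound (f g : R -> R) (a b k m : R) :
  a <= b -> ex_RInt f a b -> ex_RInt g a b ->
  (forall t, a <= t <= b -> Rabs (f t - g t - k) <= m) ->
  Rabs (RInt f a b - RInt g a b - (b - a) * k) <= (b - a) * m.
Proof.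
intros Hab Hf Hg H.
apply (norm_RInt_le_const (fun t => minus (minus (f t) (g t)) k)
  a b (minus (minus (RInt f a b) (RInt g a b)) (scal (b - a) k)) m Hab H).
apply (is_RInt_minus (V := R_NormedModule)).
- apply (is_RInt_minus (V := R_NormedModule));
    apply (RInt_correct (V := R_CompleteNormedModule)); assumption.
- apply (is_RInt_const (V := R_NormedModule)).
Qed.

(** Opposite sides are compared in pairs. The affine parts contribute (b - a) p2 (c - d) and (d - c)
    p2 (b - a), which cancel because P and Q share [p2]; only the remainders, at most [m] each, are
    left. *)
Lemma circulation_local_bound (P Q : R -> R -> R)
  (a b c d x y P0 Q0 p1 p2 q2 m : R) :
  a <= b -> c <= d -> closed_form_on P Q a b c d ->
  (forall u v, a <= u <= b -> c <= v <= d ->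
     Rabs (P u v - P0 - (p1 * (u - x) + p2 * (v - y))) <= m /\
     Rabs (Q u v - Q0 - (p2 * (u - x) + q2 * (v - y))) <= m) ->
  Rabs (circulation P Q a b c d) <= 2 * m * ((b - a) + (d - c)).
Proof.
intros Hab Hcd HC H.
destruct (closed_form_ex_RInt _ _ _ _ _ _ HC) as [HP HQ].
assert (H1 : Rabs (RInt (fun u => P u c) a b - RInt (fun u => P u d) a b
                   - (b - a) * (p2 * (c - d))) <= (b - a) * (2 * m)).
{ apply RInt_difference_bound; [exact Hab|apply HP; lra|apply HP; lra|].
  intros t Ht; destruct (H t c) as [h1 _]; [lra|lra|].
  destruct (H t d) as [h2 _]; [lra|lra|].
  apply Rabs_le_between in h1; apply Rabs_le_between in h2.
  apply Rabs_le_between; lra. }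
assert (H2 : Rabs (RInt (fun v => Q b v) c d - RInt (fun v => Q a v) c d
                   - (d - c) * (p2 * (b - a))) <= (d - c) * (2 * m)).
{ apply RInt_difference_bound; [exact Hcd|apply HQ; lra|apply HQ; lra|].
  intros t Ht; destruct (H a t) as [_ h1]; [lra|lra|].
  destruct (H b t) as [_ h2]; [lra|lra|].
  apply Rabs_le_between in h1; apply Rabs_le_between in h2.
  apply Rabs_le_between; lra. }
unfold circulation.
apply Rabs_le_between in H1; apply Rabs_le_between in H2.
apply Rabs_le_between; nra.
Qed.

Lemma circulation_split (P Q : R -> R -> R) (a b c d e f : R) :
  a <= e <= b -> c <= f <= d -> closed_form_on P Q a b c d ->
  circulation P Q a b c d =
    circulation P Q a e c f + circulation P Q e b c f +
    circulation P Q a e f d + circulation P Q e b f d.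
Proof.
intros He Hf HC; destruct (closed_form_ex_RInt _ _ _ _ _ _ HC) as [HP HQ].
assert (CP : forall y, c <= y <= d ->
  RInt (fun x => P x y) a b = RInt (fun x => P x y) a e + RInt (fun x => P x y) e b).
{ intros y Hy; symmetry; apply (RInt_Chasles (V := R_CompleteNormedModule)); apply HP; lra. }
assert (CQ : forall x, a <= x <= b ->
  RInt (fun y => Q x y) c d = RInt (fun y => Q x y) c f + RInt (fun y => Q x y) f d).
{ intros x Hx; symmetry; apply (RInt_Chasles (V := R_CompleteNormedModule)); apply HQ; lra. }
unfold circulation.
rewrite !CP, !CQ by lra. lra.
Qed.

(* Goursat's bisection: no continuity of the partial derivatives is assumed. *)
Lemma circulation_closed_form (P Q : R -> R -> R) (a b c d : R) :
  a <= b -> c <= d -> closed_form_on P Q a b c d -> circulation P Q a b c d = 0.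
Proof.
intros Hab Hcd HC.
destruct (Req_dec (circulation P Q a b c d) 0) as [H0|H0]; [exact H0|exfalso].
set (K := Rabs (circulation P Q a b c d)).
assert (HK : 0 < K) by (apply Rabs_pos_lt; exact H0).
assert (Half : forall r n, r / 2 ^ S n + r / 2 ^ S n = r / 2 ^ n).
{ intros r n; simpl; field; apply pow_nonzero; lra. }
assert (Pos : forall r n, 0 <= r -> 0 <= r / 2 ^ n).
{ intros r n Hr; apply Rmult_le_pos; [exact Hr|].
  left; apply Rinv_0_lt_compat, pow_lt; lra. }
set (A := b - a); set (B := d - c).
assert (HA : 0 <= A) by (unfold A; lra); assert (HB : 0 <= B) by (unfold B; lra).
destruct (rectangle_bisection A B a c (fun n x y =>
  K / 4 ^ n <= Rabs (circulation P Q x (x + A / 2 ^ n) y (y + B / 2 ^ n))))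
  as [xs [ys Hsy]]; [exact HA|exact HB| | |].
{ replace (a + A / 2 ^ 0) with b by (unfold A; simpl; field).
  replace (c + B / 2 ^ 0) with d by (unfold B; simpl; field).
  unfold K; simpl; lra. }
{ intros n x y h1 h2 h3 h4 h5.
  assert (hA := Half A n); assert (hB := Half B n).
  assert (pA := Pos A (S n) HA); assert (pB := Pos B (S n) HB).
  rewrite (circulation_split P Q x (x + A / 2 ^ n) y (y + B / 2 ^ n)
     (x + A / 2 ^ S n) (y + B / 2 ^ S n)) in h5; [|lra|lra|].
  2:{ intros u v Hu Hv; apply HC; unfold A, B in *; lra. }
  assert (h6 : K / 4 ^ n = 4 * (K / 4 ^ S n))
    by (simpl; field; apply pow_nonzero; lra).
  assert (e1 : x + A / 2 ^ n = x + A / 2 ^ S n + A / 2 ^ S n) by lra.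
  assert (e2 : y + B / 2 ^ n = y + B / 2 ^ S n + B / 2 ^ S n) by lra.
  rewrite e1, e2, h6 in h5.
  set (xm := x + A / 2 ^ S n) in *; set (ym := y + B / 2 ^ S n) in *.
  set (k := K / 4 ^ S n) in *.
  (* The four quarters add up to a circulation of modulus at least 4k, so they cannot all stay below
     [k]. *)
  destruct (Rle_dec k (Rabs (circulation P Q x xm y ym))) as [t1|t1].
  { exists x, y; auto. }
  destruct (Rle_dec k (Rabs (circulation P Q xm (xm + A / 2 ^ S n) y ym))) as [t2|t2].
  { exists xm, y; auto. }
  destruct (Rle_dec k (Rabs (circulation P Q x xm ym (ym + B / 2 ^ S n)))) as [t3|t3].
  { exists x, ym; auto. }
  exists xm, ym; repeat split; auto.
  revert h5.
  set (c1 := circulation P Q x xm y ym) in *;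
  set (c2 := circulation P Q xm (xm + A / 2 ^ S n) y ym) in *;
  set (c3 := circulation P Q x xm ym (ym + B / 2 ^ S n)) in *;
  set (c4 := circulation P Q xm _ ym _).
  intros h5; generalize (Rabs_triang (c1 + c2 + c3) c4) (Rabs_triang (c1 + c2) c3)
    (Rabs_triang c1 c2); lra. }
assert (Hin : a <= xs <= b /\ c <= ys <= d).
{ destruct (Hsy O) as [x [y Hxy]]; unfold A, B in *; lra. }
destruct (HC xs ys) as [p1 [p2 [q2 [DP DQ]]]]; [tauto|tauto|].
(* The summand 1 keeps [L] positive for a degenerate rectangle. With eps = K / (4 L^2) the local
   bound at level n becomes K / (2 * 4^n), half of what badness demands. *)
set (L := A + B + 1).
assert (HL : 0 < L) by (unfold L; lra).
assert (Heps : 0 < K / (4 * L ^ 2))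
  by (apply Rdiv_lt_0_compat; [exact HK|]; assert (0 < L ^ 2) by (apply pow_lt; lra); lra).
set (eps := mkposreal _ Heps).
destruct (DP eps) as [d1 Hd1]; destruct (DQ eps) as [d2 Hd2].
set (del := Rmin d1 d2).
assert (Hdel : 0 < del) by (apply Rmin_glb_lt; apply cond_pos).
destruct (pow_lt_1_zero (/ 2)) with (y := del / L) as [n Hn].
{ rewrite Rabs_pos_eq; lra. }
{ apply Rdiv_lt_0_compat; assumption. }
specialize (Hn n (Nat.le_refl n)).
assert (Hp : 0 < 2 ^ n) by (apply pow_lt; lra).
rewrite pow_inv, Rabs_pos_eq in Hn by (left; apply Rinv_0_lt_compat, Hp).
assert (Hn' : L / 2 ^ n < del).
{ apply (Rmult_lt_compat_l L) in Hn; [|exact HL].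
  replace (L * (del / L)) with del in Hn by (field; lra). exact Hn. }
destruct (Hsy n) as [x [y [h1 [h2 [h3 [h4 [h5 [h6 h7]]]]]]]].
assert (Hi : 0 < / 2 ^ n) by (apply Rinv_0_lt_compat, Hp).
assert (hL : L / 2 ^ n = A / 2 ^ n + B / 2 ^ n + / 2 ^ n) by (unfold L; field; lra).
assert (pA := Pos A n HA); assert (pB := Pos B n HB).
assert (Hb := circulation_local_bound P Q x (x + A / 2 ^ n) y (y + B / 2 ^ n)
  xs ys (P xs ys) (Q xs ys) p1 p2 q2 (eps * (L / 2 ^ n))).
assert (Hfin : Rabs (circulation P Q x (x + A / 2 ^ n) y (y + B / 2 ^ n))
  <= 2 * (eps * (L / 2 ^ n)) * (L / 2 ^ n)).
{ eapply Rle_trans; [apply Hb|].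
  - lra.
  - lra.
  - intros u v Hu Hv; apply HC; unfold A, B in *; lra.
  - intros u v Hu Hv.
    assert (Hux : Rabs (u - xs) <= L / 2 ^ n) by (apply Rabs_le_between; lra).
    assert (Hvy : Rabs (v - ys) <= L / 2 ^ n) by (apply Rabs_le_between; lra).
    assert (Hm := Rmax_lub _ _ _ Hux Hvy).
    assert (Hle : eps * Rmax (Rabs (u - xs)) (Rabs (v - ys)) <= eps * (L / 2 ^ n))
      by (apply Rmult_le_compat_l; [left; apply cond_pos|exact Hm]).
    generalize (Rmin_l d1 d2) (Rmin_r d1 d2); fold del; intros.
    split; eapply Rle_trans; try exact Hle; [apply Hd1|apply Hd2]; lra.
  - apply Rmult_le_compat_l; [|lra].
    assert (0 < eps * (L / 2 ^ n)); [|lra].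
    apply Rmult_lt_0_compat; [apply cond_pos|lra]. }
assert (E : 2 * (eps * (L / 2 ^ n)) * (L / 2 ^ n) = K / 4 ^ n / 2).
{ unfold eps; simpl pos. replace 4 with (2 * 2) at 2 by ring.
  rewrite Rpow_mult_distr; field; split; lra. }
assert (0 < K / 4 ^ n) by (apply Rdiv_lt_0_compat; [exact HK|apply pow_lt; lra]).
lra.
Qed.

(** * The mean value property *)

Lemma differentiable_pt_lim_Rmult (x y : R) :
  differentiable_pt_lim Rmult x y y x.
Proof.
intros eps; exists eps; intros u v Hu Hv.
replace (u * v - x * y - (y * (u - x) + x * (v - y))) with ((u - x) * (v - y)) by ring.
rewrite Rabs_mult, Rmult_comm.
apply Rmult_le_compat; try apply Rabs_pos; [lra|apply Rmax_l].
Qed.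

Lemma differentiable_pt_lim_snd (g : R -> R) (x y l : R) :
  derivable_pt_lim g y l -> differentiable_pt_lim (fun _ v => g v) x y 0 l.
Proof.
intros H.
assert (Hs : differentiable_pt_lim (fun _ v => v) x y 0 1).
{ intros eps; exists (mkposreal 1 Rlt_0_1); intros u v _ _.
  replace (v - y - (0 * (u - x) + 1 * (v - y))) with 0 by ring.
  rewrite Rabs_R0; apply Rmult_le_pos; [left; apply cond_pos|].
  eapply Rle_trans; [apply Rabs_pos|apply Rmax_l]. }
replace 0 with (l * 0 + 0 * 0) by ring; replace l with (l * 1 + 0 * 1) at 2 by ring.
exact (differentiable_pt_lim_comp (fun u _ => g u) (fun _ v => v) (fun _ v => v)
  x y l 0 0 1 0 1 (differentiable_pt_lim_proj1_0 g y _ l H) Hs Hs).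
Qed.

Lemma differentiable_pt_lim_mult_fct (g h : R -> R) (x y lg lh : R) :
  derivable_pt_lim g x lg -> derivable_pt_lim h y lh ->
  differentiable_pt_lim (fun u v => g u * h v) x y (lg * h y) (g x * lh).
Proof.
intros Hg Hh.
replace (lg * h y) with (h y * lg + g x * 0) by ring.
replace (g x * lh) with (h y * 0 + g x * lh) by ring.
apply (differentiable_pt_lim_comp Rmult (fun u _ => g u) (fun _ v => h v)).
- apply differentiable_pt_lim_Rmult.
- apply differentiable_pt_lim_proj1_0, Hg.
- apply differentiable_pt_lim_snd, Hh.
Qed.

(** Multiplication by l1 + i l2 is the real matrix with rows (l1, -l2) and (l2, l1), and the two
    real remainders are the real and imaginary parts of the complex one. *)
Lemma cauchy_riemann (k : C -> C) (x y : R) :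
  cdiff k (x, y) -> exists l1 l2,
    differentiable_pt_lim (fun u v => Re (k (u, v))) x y l1 (- l2) /\
    differentiable_pt_lim (fun u v => Im (k (u, v))) x y l2 l1.
Proof.
intros [[l1 l2] Hl]; exists l1, l2.
assert (H : forall eps : posreal, locally_2d (fun u v =>
   Cmod (k (u, v) - k (x, y) - ((u, v) - (x, y)) * (l1, l2))%C
     <= eps * Rmax (Rabs (u - x)) (Rabs (v - y))) x y).
{ intros eps.
  (* Half of [eps] pays for the comparison of norms: the modulus is at most sqrt 2, hence at most 2,
     times the maximum norm. *)
  destruct (proj1 (is_derive_C_eps k (x, y) (l1, l2)) Hl (eps / 2)) as [d [Hd H]].
  { apply is_pos_div_2. }
  assert (Hd2 : 0 < d / 2) by lra.
  exists (mkposreal _ Hd2); intros u v Hu Hv; simpl in Hu, Hv.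
  assert (Hle : Cmod ((u, v) - (x, y))%C <= 2 * Rmax (Rabs (u - x)) (Rabs (v - y))).
  { eapply Rle_trans; [apply Cmod_2Rmax|]; simpl.
    apply Rmult_le_compat_r.
    - eapply Rle_trans; [apply Rabs_pos|apply Rmax_l].
    - rewrite <- (sqrt_square 2) at 2 by lra; apply sqrt_le_1_alt; lra. }
  eapply Rle_trans; [apply H|].
  - eapply Rle_lt_trans; [exact Hle|].
    assert (Rmax (Rabs (u - x)) (Rabs (v - y)) < d / 2) by (apply Rmax_lub_lt; assumption).
    lra.
  - apply (Rmult_le_compat_l (eps / 2)) in Hle; [|left; apply is_pos_div_2]. lra. }
assert (HI : forall z : C, Rabs (Im z) <= Cmod z)
  by (intros z; eapply Rle_trans; [apply Rmax_r|apply Rmax_Cmod]).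
split; intros eps; destruct (H eps) as [d Hd]; exists d; intros u v Hu Hv;
  (eapply Rle_trans; [|apply (Hd u v Hu Hv)]).
- eapply Rle_trans; [|apply re_le_Cmod]; right; f_equal.
  unfold Re, Im; simpl; ring.
- eapply Rle_trans; [|apply HI]; right; f_equal.
  unfold Re, Im; simpl; ring.
Qed.

Definition polar (r t : R) : C := (r * cos t, r * sin t).

Lemma Cmod_polar (r t : R) : 0 <= r -> Cmod (polar r t) = r.
Proof.
intros Hr; unfold Cmod, polar; simpl.
replace (_ + _) with (r * r * (Rsqr (sin t) + Rsqr (cos t))) by (unfold Rsqr; ring).
rewrite sin2_cos2, Rmult_1_r; apply sqrt_square, Hr.
Qed.

(** In the coordinates (r, t) this is the real part of k(z) dz / (iz), that is Im k dr/r + Re k dt.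
    It is closed away from the origin by the Cauchy-Riemann equations. *)
Lemma polar_closed_form (k : C -> C) (a b c d : R) :
  holomorphic_on_disk k -> 0 < a -> b < 1 ->
  closed_form_on (fun r t => / r * Im (k (polar r t))) (fun r t => Re (k (polar r t)))
    a b c d.
Proof.
intros Hk Ha Hb r t Hr Ht.
destruct (cauchy_riemann k (r * cos t) (r * sin t)) as [l1 [l2 [HU HV]]].
{ apply Hk; unfold in_disk; change (Cmod (polar r t) < 1); rewrite Cmod_polar; lra. }
assert (Hx : differentiable_pt_lim (fun u v => u * cos v) r t (1 * cos t) (r * - sin t)).
{ apply differentiable_pt_lim_mult_fct; [apply derivable_pt_lim_id|apply derivable_pt_lim_cos]. }
assert (Hy : differentiable_pt_lim (fun u v => u * sin v) r t (1 * sin t) (r * cos t)).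
{ apply differentiable_pt_lim_mult_fct; [apply derivable_pt_lim_id|apply derivable_pt_lim_sin]. }
assert (DU := differentiable_pt_lim_comp _ _ _ _ _ _ _ _ _ _ _ HU Hx Hy).
assert (DV := differentiable_pt_lim_comp _ _ _ _ _ _ _ _ _ _ _ HV Hx Hy).
assert (Hi : differentiable_pt_lim (fun u _ => / u) r t (- / r ^ 2) 0).
{ apply differentiable_pt_lim_proj1_0.
  apply is_derive_Reals; auto_derive; [lra|field; lra]. }
assert (DP := differentiable_pt_lim_comp Rmult _ _ _ _ _ _ _ _ _ _
  (differentiable_pt_lim_Rmult _ _) Hi DV).
cbn beta in DP, DU.
eexists; eexists; eexists; split; [exact DP|].
match goal with |- differentiable_pt_lim _ _ _ ?p _ =>
  replace p with (l1 * (1 * cos t) + - l2 * (1 * sin t)) by (field; lra) end.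
exact DU.
Qed.

(** Over the rectangle [a,r] x [0,2 PI] the two radial sides cancel by periodicity, so the angular
    integrals over the circles of radius [a] and [r] agree. For small [a] the first is close to 2 PI
    Re k(0), while the second is at most 2 PI M. This one-sided form is all that the maximum
    principle needs. *)
Lemma mean_value_bound (k : C -> C) (r M : R) :
  holomorphic_on_disk k -> 0 < r < 1 ->
  (forall w, Cmod w = r -> Re (k w) <= M) -> Re (k (RtoC 0)) <= M.
Proof.
intros Hk Hr HM.
apply le_epsilon; intros eps Heps.
destruct (cdiff_continuous k (RtoC 0)) with (eps := eps) as [d [Hd Hcont]].
{ apply Hk; unfold in_disk; rewrite Cmod_0; lra. }
{ exact Heps. }
set (a := Rmin (d / 2) r).
assert (Ha : 0 < a) by (apply Rmin_glb_lt; lra).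
assert (Har : a <= r) by apply Rmin_r.
assert (Had : a < d) by (generalize (Rmin_l (d / 2) r); fold a; lra).
assert (H2pi : 0 < 2 * PI) by (generalize PI_RGT_0; lra).
assert (HC := polar_closed_form k a r 0 (2 * PI) Hk Ha (proj2 Hr)).
assert (HE := circulation_closed_form _ _ a r 0 (2 * PI) Har (Rlt_le _ _ H2pi) HC).
destruct (closed_form_ex_RInt _ _ _ _ _ _ HC) as [_ HQ].
unfold circulation in HE.
assert (Eper : RInt (fun x => / x * Im (k (polar x 0))) a r =
  RInt (fun x => / x * Im (k (polar x (2 * PI)))) a r).
{ apply RInt_ext; intros x _; unfold polar; rewrite cos_0, sin_0, cos_2PI, sin_2PI.
  reflexivity. }
rewrite Eper in HE.
assert (Hup : RInt (fun t => Re (k (polar r t))) 0 (2 * PI) <= RInt (fun _ => M) 0 (2 * PI)).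
{ apply RInt_le; [lra|apply HQ; lra|apply ex_RInt_const|].
  intros t _; apply HM, Cmod_polar; lra. }
assert (Hlo : RInt (fun _ => Re (k (RtoC 0)) - eps) 0 (2 * PI) <=
  RInt (fun t => Re (k (polar a t))) 0 (2 * PI)).
{ apply RInt_le; [lra|apply ex_RInt_const|apply HQ; lra|].
  intros t _.
  assert (h : Cmod (k (polar a t) - k 0)%C < eps).
  { apply Hcont. replace (polar a t - 0)%C with (polar a t) by ring.
    rewrite Cmod_polar; lra. }
  generalize (re_le_Cmod (k (polar a t) - k 0)%C); intros h2.
  apply Rabs_le_between in h2.
  change (Re (k (polar a t) - k 0)%C) with (Re (k (polar a t)) - Re (k (RtoC 0))) in h2.
  lra. }
rewrite RInt_const in Hup, Hlo.
change scal with Rmult in Hup, Hlo; simpl in Hup, Hlo.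
assert (H : (2 * PI - 0) * (Re (k (RtoC 0)) - eps) <= (2 * PI - 0) * M) by lra.
apply Rmult_le_reg_l in H; lra.
Qed.

(** * Maximum principle and Schwarz-Pick *)

(** The Moebius automorphism of the disk that carries 0 to [a]; its inverse is [disk_aut (- a)]. *)
Definition disk_aut (a w : C) : C := ((w + a) / (1 + Cconj a * w))%C.

Lemma Cmod_sqr_re_im (z : C) : Cmod z * Cmod z = Re z * Re z + Im z * Im z.
Proof. generalize (Cmod2_alt z); simpl; rewrite !Rmult_1_r; tauto. Qed.

Lemma disk_aut_den (a w : C) : in_disk a -> in_disk w ->
  1 - Cmod a <= Cmod (1 + Cconj a * w) /\ (1 + Cconj a * w)%C <> RtoC 0.
Proof.
unfold in_disk; intros Ha Hw.
assert (H := Cmod_triangle (1 + Cconj a * w) (- (Cconj a * w))).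
replace (1 + Cconj a * w + - (Cconj a * w))%C with (RtoC 1) in H by ring.
rewrite Cmod_1, Cmod_opp, Cmod_mult, Cmod_conj in H.
assert (h := Cmod_ge_0 a); assert (h' := Cmod_ge_0 w).
assert (H1 : 1 - Cmod a <= Cmod (1 + Cconj a * w)) by nra.
split; [exact H1|]. apply Cmod_gt_0; lra.
Qed.

Lemma disk_aut_identity (a w : C) :
  Cmod (1 + Cconj a * w) * Cmod (1 + Cconj a * w) - Cmod (w + a) * Cmod (w + a)
  = (1 - Cmod a * Cmod a) * (1 - Cmod w * Cmod w).
Proof.
rewrite !Cmod_sqr_re_im; destruct a as [a1 a2], w as [w1 w2]; unfold Re, Im; simpl; ring.
Qed.

Lemma disk_aut_Cmod (a w : C) : in_disk a -> in_disk w ->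
  (1 - Cmod (disk_aut a w) * Cmod (disk_aut a w)) *
    (Cmod (1 + Cconj a * w) * Cmod (1 + Cconj a * w))
  = (1 - Cmod a * Cmod a) * (1 - Cmod w * Cmod w).
Proof.
intros Ha Hw; destruct (disk_aut_den a w Ha Hw) as [_ Hd].
rewrite <- disk_aut_identity; unfold disk_aut; rewrite Cmod_div by exact Hd.
field. apply Rgt_not_eq, Cmod_gt_0, Hd.
Qed.

Lemma disk_aut_in_disk (a w : C) : in_disk a -> in_disk w -> in_disk (disk_aut a w).
Proof.
intros Ha Hw; assert (H := disk_aut_Cmod a w Ha Hw).
destruct (disk_aut_den a w Ha Hw) as [_ Hd]; apply Cmod_gt_0 in Hd.
unfold in_disk in *.
generalize (Cmod_ge_0 a) (Cmod_ge_0 w) (Cmod_ge_0 (disk_aut a w)); intros.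
assert (HD : 0 < Cmod (1 + Cconj a * w) * Cmod (1 + Cconj a * w))
  by (apply Rmult_lt_0_compat; exact Hd).
assert (Hpos : 0 < (1 - Cmod a * Cmod a) * (1 - Cmod w * Cmod w))
  by (apply Rmult_lt_0_compat; nra).
rewrite <- H in Hpos.
assert (0 < 1 - Cmod (disk_aut a w) * Cmod (disk_aut a w)).
{ eapply Rmult_lt_reg_r; [exact HD|]. rewrite Rmult_0_l; exact Hpos. }
nra.
Qed.

Lemma disk_aut_cdiff (a w : C) : in_disk a -> in_disk w -> cdiff (disk_aut a) w.
Proof.
intros Ha Hw; apply cdiff_div; [apply disk_aut_den; assumption| |].
- apply cdiff_plus; [apply cdiff_id|apply cdiff_const].
- apply cdiff_plus; [apply cdiff_const|].
  apply cdiff_mult; [apply cdiff_const|apply cdiff_id].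
Qed.

Lemma disk_aut_0 (a : C) : disk_aut a 0 = a.
Proof. unfold disk_aut; field. Qed.

Lemma in_disk_opp (a : C) : in_disk a -> in_disk (- a).
Proof. unfold in_disk; rewrite Cmod_opp; tauto. Qed.

Lemma disk_aut_opp_l (a z : C) :
  in_disk a -> in_disk z -> disk_aut a (disk_aut (- a) z) = z.
Proof.
intros Ha Hz; assert (Ha' := in_disk_opp _ Ha).
destruct (disk_aut_den _ _ Ha' Hz) as [_ H1].
destruct (disk_aut_den _ _ Ha (disk_aut_in_disk _ _ Ha' Hz)) as [_ H2].
unfold disk_aut in *; rewrite Copp_conj in *.
field; split; [exact H1|].
intros E; apply H2.
replace (1 + Cconj a * ((z + - a) / (1 + - Cconj a * z)))%C
  with ((1 + - Cconj a * z + Cconj a * (z + - a)) / (1 + - Cconj a * z))%C by (field; exact H1).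
rewrite E; field; exact H1.
Qed.

(** No maximum has to be attained: [disk_aut z] moves [z] to the centre, and a circle of radius
    close to 1 is carried into the annulus where the bound is known. The mean value bound then
    applies at the centre. *)
Lemma maximum_modulus (k : C -> C) (r0 B : R) (z : C) :
  holomorphic_on_disk k -> 0 <= r0 < 1 ->
  (forall w, in_disk w -> r0 <= Cmod w -> Cmod (k w) <= B) ->
  in_disk z -> Cmod (k z) <= B.
Proof.
intros Hk Hr0 HB Hz.
assert (Hz' := Hz); unfold in_disk in Hz'; assert (Hz0 := Cmod_ge_0 z).
assert (HB0 : 0 <= B).
{ apply Rle_trans with (Cmod (k (RtoC r0))); [apply Cmod_ge_0|].
  apply HB; unfold in_disk; rewrite Cmod_R, Rabs_pos_eq; lra. }
(* For |w| = r this gives (1 - |z|^2)(1 - r^2) <= (1 - r0)(1 - |z|)^2. An image of modulus below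
   [r0] would, by [disk_aut_Cmod], make the left side exceed (1 - r0^2)(1 - |z|)^2. *)
set (r := 1 - (1 - r0) * (1 - Cmod z) / 4).
assert (Hr : 0 < r < 1) by (unfold r; nra).
(* The factor conj k(z) rotates the value at the centre to the real number |k(z)|^2, so a bound on
   real parts yields a bound on the modulus. *)
assert (H : Re (Cconj (k z) * k (disk_aut z 0)) <= Cmod (k z) * B).
{ apply (mean_value_bound (fun w => Cconj (k z) * k (disk_aut z w))%C r); [|exact Hr|].
  - intros w Hw; apply cdiff_mult; [apply cdiff_const|].
    apply cdiff_comp; [apply Hk, disk_aut_in_disk|apply disk_aut_cdiff]; assumption.
  - intros w Hw.
    assert (Hwd : in_disk w) by (unfold in_disk; lra).
    eapply Rle_trans; [apply Rle_abs|]; eapply Rle_trans; [apply re_le_Cmod|].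
    rewrite Cmod_mult, Cmod_conj; apply Rmult_le_compat_l; [apply Cmod_ge_0|].
    apply HB; [apply disk_aut_in_disk; assumption|].
    assert (E := disk_aut_Cmod z w Hz Hwd); rewrite Hw in E.
    destruct (disk_aut_den z w Hz Hwd) as [Hd _].
    assert (T0 := Cmod_ge_0 (disk_aut z w)).
    set (t := Cmod (disk_aut z w)) in *; set (D := Cmod (1 + Cconj z * w)) in *.
    set (m := Cmod z) in *.
    destruct (Rle_lt_dec r0 t) as [|Ht]; [assumption|exfalso].
    assert (h1 : 1 - r0 * r0 < 1 - t * t) by nra.
    assert (h2 : (1 - m) * (1 - m) <= D * D) by nra.
    assert (h3 : 0 < (1 - m) * (1 - m)) by nra.
    assert (h4 : (1 - r0 * r0) * ((1 - m) * (1 - m)) < (1 - t * t) * (D * D)).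
    { apply Rlt_le_trans with ((1 - t * t) * ((1 - m) * (1 - m))).
      - apply Rmult_lt_compat_r; assumption.
      - apply Rmult_le_compat_l; nra. }
    rewrite E in h4.
    assert (h5 : 1 - r * r <= (1 - r0) * (1 - m) / 2).
    { assert (1 - r = (1 - r0) * (1 - m) / 4) by (unfold r; ring).
      generalize (pow2_ge_0 (1 - r)); nra. }
    assert (h6 : (1 - m * m) * (1 - r * r) <= 2 * (1 - m) * ((1 - r0) * (1 - m) / 2)).
    { apply Rmult_le_compat; nra. }
    assert (h7 : (1 - r0) * ((1 - m) * (1 - m)) <= (1 - r0 * r0) * ((1 - m) * (1 - m)))
      by (apply Rmult_le_compat_r; nra).
    lra. }
rewrite disk_aut_0 in H.
assert (E : Re (Cconj (k z) * k z) = Cmod (k z) * Cmod (k z)).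
{ rewrite Cmod_sqr_re_im; unfold Re, Im; simpl; ring. }
rewrite E in H.
destruct (Cmod_ge_0 (k z)) as [Hp|<-]; [|exact HB0].
apply Rmult_le_reg_l in H; assumption.
Qed.

(** The outer factor [w] annihilates whatever value the quotient takes at 0, and the difference
    quotient at 0 is (phi w / w)^m, which tends to l^m. *)
Lemma cdiff_mult_slope_pow (phi : C -> C) (m : nat) :
  phi (RtoC 0) = RtoC 0 -> cdiff phi (RtoC 0) ->
  cdiff (fun w => w * (phi w / w) ^ m)%C (RtoC 0).
Proof.
intros H0 [l Hl]; exists (l ^ m)%C.
apply is_derive_C_eps; intros eps He.
destruct (cdiff_continuous (fun x => x ^ m)%C l) with (eps := eps) as [d1 [Hd1 H1]].
{ apply cdiff_pow, cdiff_id. }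
{ exact He. }
assert (Hh : 0 < d1 / 2) by lra.
destruct (proj1 (is_derive_C_eps phi (RtoC 0) l) Hl _ Hh) as [d [Hd H]].
exists d; split; [exact Hd|]; intros w Hw.
replace (w - 0)%C with w in * by ring.
destruct (Ceq_dec w (RtoC 0)) as [E|E].
{ rewrite E; rewrite !Cmult_0_l.
  replace (0 - 0 - 0)%C with (RtoC 0) by ring. rewrite Cmod_0; lra. }
replace (w * (phi w / w) ^ m - 0 * (phi 0 / 0) ^ m - w * l ^ m)%C
  with (w * ((phi w / w) ^ m - l ^ m))%C by ring.
rewrite Cmod_mult, Rmult_comm; apply Rmult_le_compat_r; [apply Cmod_ge_0|].
apply Rlt_le, H1.
specialize (H w). replace (w - 0)%C with w in H by ring. specialize (H Hw).
rewrite H0 in H.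
replace (phi w / w - l)%C with ((phi w - 0 - w * l) / w)%C by (field; exact E).
assert (Hp : 0 < Cmod w) by (apply Cmod_gt_0, E).
rewrite Cmod_div by exact E.
apply Rle_lt_trans with (d1 / 2); [|lra].
apply Rle_div_l; [exact Hp|exact H].
Qed.

(* The maximum principle is applied to [w (phi w / w)^m], which is complex
   differentiable at [0] without any removable-singularity theorem. *)
Lemma schwarz (phi : C -> C) (z : C) :
  holomorphic_on_disk phi -> (forall w, in_disk w -> Cmod (phi w) <= 1) ->
  phi (RtoC 0) = RtoC 0 -> in_disk z -> Cmod (phi z) <= Cmod z.
Proof.
intros Hphi Hb H0 Hz.
destruct (Ceq_dec z (RtoC 0)) as [->|Hz0]; [rewrite H0; lra|].
assert (Hzp : 0 < Cmod z) by (apply Cmod_gt_0, Hz0).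
destruct (Rle_lt_dec (Cmod (phi z)) (Cmod z)) as [|Hlt]; [assumption|exfalso].
set (s := Cmod (phi z) / Cmod z).
assert (Hs : 1 < s) by (apply Rlt_div_r; lra).
(* Chosen so that 1/s < r0 < 1. On |w| >= r0 the quotient phi w / w has modulus at most 1/r0, so the
   maximum principle gives |z| s^m <= r0^(-m) for every m, against (s r0)^m -> infinity. *)
set (r0 := 2 / (1 + s)).
assert (Hr0 : 0 < r0 < 1).
{ unfold r0; split; [apply Rdiv_lt_0_compat; lra|apply Rlt_div_l; lra]. }
assert (Hi : 0 < / r0) by (apply Rinv_0_lt_compat; lra).
assert (Hm : forall m, Cmod z * s ^ m <= (/ r0) ^ m).
{ intros m.
  replace (Cmod z * s ^ m) with (Cmod (z * (phi z / z) ^ m)%C)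
    by (rewrite Cmod_mult, Cmod_pow, Cmod_div; auto).
  apply (maximum_modulus (fun w => w * (phi w / w) ^ m)%C r0); [|lra| |exact Hz].
  - intros w Hw; destruct (Ceq_dec w (RtoC 0)) as [->|Hw0].
    + apply cdiff_mult_slope_pow; [exact H0|apply Hphi, Hw].
    + apply cdiff_mult; [apply cdiff_id|].
      apply cdiff_pow, cdiff_div; [exact Hw0|apply Hphi, Hw|apply cdiff_id].
  - intros w Hw Hrw.
    assert (Hw0 : w <> RtoC 0) by (apply Cmod_gt_0; lra).
    rewrite Cmod_mult, Cmod_pow, Cmod_div by exact Hw0.
    rewrite <- (Rmult_1_l ((/ r0) ^ m)).
    apply Rmult_le_compat; [lra| |unfold in_disk in Hw; lra|].
    + apply pow_le, Rdiv_le_0_compat; [apply Cmod_ge_0|lra].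
    + apply pow_incr; split; [apply Rdiv_le_0_compat; [apply Cmod_ge_0|lra]|].
      apply Rle_trans with (1 / Cmod w).
      * apply Rmult_le_compat_r; [left; apply Rinv_0_lt_compat; lra|apply Hb, Hw].
      * unfold Rdiv; rewrite Rmult_1_l; apply Rinv_le_contravar; lra. }
assert (Hx : 1 < s * r0) by (unfold r0; apply (Rmult_lt_reg_r (1 + s)); [lra|];
  replace (s * (2 / (1 + s)) * (1 + s)) with (2 * s) by (field; lra); lra).
destruct (Pow_x_infinity (s * r0)) with (b := / Cmod z + 1) as [n Hn].
{ rewrite Rabs_pos_eq; lra. }
specialize (Hn n (Nat.le_refl n)); specialize (Hm n).
rewrite Rabs_pos_eq in Hn by (apply pow_le; lra).
assert (Hrn : 0 < r0 ^ n) by (apply pow_lt; lra).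
apply (Rmult_le_compat_r (r0 ^ n)) in Hm; [|lra].
rewrite <- Rpow_mult_distr, Rinv_l, pow1, Rmult_assoc, <- Rpow_mult_distr in Hm by lra.
apply Rge_le, (Rmult_le_compat_l (Cmod z)) in Hn; [|lra].
rewrite Rmult_plus_distr_l, Rinv_r in Hn by lra. lra.
Qed.

(** Schwarz's lemma for [h] precomposed with [disk_aut a] and followed by the Cayley map x -> (x - h
    a)/(x + conj (h a)), which sends the right half-plane to the disk and h(a) to 0. *)
Lemma half_plane_pick_pos (h : C -> C) (a z : C) :
  holomorphic_on_disk h -> (forall w, in_disk w -> 0 < Re (h w)) ->
  in_disk a -> in_disk z ->
  Cmod (h z - h a) * Cmod (1 - Cconj a * z) <= Cmod (z - a) * Cmod (h z + Cconj (h a)).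
Proof.
intros Hh Hpos Ha Hz.
assert (Hden : forall w, in_disk w -> (h w + Cconj (h a))%C <> RtoC 0).
{ intros w Hw E; apply (f_equal Re) in E.
  generalize (Hpos w Hw) (Hpos a Ha); unfold Re in *; simpl in *; lra. }
assert (Ha' := in_disk_opp _ Ha).
assert (S := schwarz (fun w => (h (disk_aut a w) - h a) / (h (disk_aut a w) + Cconj (h a)))%C
  (disk_aut (- a) z)).
cbv beta in S; rewrite disk_aut_opp_l, disk_aut_0 in S by assumption.
assert (S' : Cmod ((h z - h a) / (h z + Cconj (h a)))%C <= Cmod (disk_aut (- a) z)).
{ apply S.
  - intros w Hw; assert (Hw' := disk_aut_in_disk a w Ha Hw).
    assert (Hc : cdiff (fun w => h (disk_aut a w)) w).
    { apply cdiff_comp; [apply Hh, Hw'|apply disk_aut_cdiff; assumption]. }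
    apply cdiff_div; [apply Hden, Hw'| |].
    + apply cdiff_minus; [exact Hc|apply cdiff_const].
    + apply cdiff_plus; [exact Hc|apply cdiff_const].
  - intros w Hw; assert (Hw' := disk_aut_in_disk a w Ha Hw).
    rewrite Cmod_div by (apply Hden, Hw').
    apply Rle_div_l; [apply Cmod_gt_0, Hden, Hw'|rewrite Rmult_1_l].
    apply Rsqr_incr_0; try apply Cmod_ge_0.
    unfold Rsqr; rewrite !Cmod_sqr_re_im.
    generalize (Hpos _ Hw') (Hpos _ Ha).
    destruct (h (disk_aut a w)) as [x1 x2], (h a) as [y1 y2]; unfold Re, Im; simpl; nra.
  - unfold Cminus; rewrite Cplus_opp_r; unfold Cdiv; apply Cmult_0_l.
  - apply disk_aut_in_disk; assumption. }
destruct (disk_aut_den _ _ Ha' Hz) as [_ Hd].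
unfold disk_aut in S'; rewrite Copp_conj in *.
rewrite !Cmod_div in S' by auto.
replace (1 - Cconj a * z)%C with (1 + - Cconj a * z)%C by ring.
replace (z - a)%C with (z + - a)%C by ring.
assert (h1 : 0 < Cmod (1 + - Cconj a * z)) by (apply Cmod_gt_0, Hd).
assert (h2 : 0 < Cmod (h z + Cconj (h a))) by (apply Cmod_gt_0, Hden, Hz).
apply (Rle_div_l _ _ _ h2) in S'.
apply (Rmult_le_compat_r (Cmod (1 + - Cconj a * z))) in S'; [|lra].
eapply Rle_trans; [exact S'|right; field; lra].
Qed.

(** Adding a constant e > 0 makes the real part strictly positive; it cancels in h z - h a and costs
    only 2e |z - a| on the right. *)
Lemma half_plane_pick (h : C -> C) (a z : C) :
  holomorphic_on_disk h -> (forall w, in_disk w -> 0 <= Re (h w)) ->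
  in_disk a -> in_disk z ->
  Cmod (h z - h a) * Cmod (1 - Cconj a * z) <= Cmod (z - a) * Cmod (h z + Cconj (h a)).
Proof.
intros Hh Hpos Ha Hz; apply le_epsilon; intros eps He.
set (e := eps / (2 * (Cmod (z - a) + 1))).
assert (h0 := Cmod_ge_0 (z - a)).
assert (He' : 0 < e) by (apply Rdiv_lt_0_compat; lra).
assert (H := half_plane_pick_pos (fun w => h w + RtoC e)%C a z).
cbv beta in H.
replace (h z + RtoC e - (h a + RtoC e))%C with (h z - h a)%C in H by ring.
eapply Rle_trans; [apply H; auto|].
- intros w Hw; apply cdiff_plus; [apply Hh, Hw|apply cdiff_const].
- intros w Hw; generalize (Hpos w Hw); unfold Re; simpl; lra.
- replace (h z + RtoC e + Cconj (h a + RtoC e))%C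
    with ((h z + Cconj (h a)) + RtoC (2 * e))%C.
  2:{ destruct (h z), (h a); unfold Cconj, Cplus, RtoC; simpl; f_equal; ring. }
  eapply Rle_trans; [apply Rmult_le_compat_l; [exact h0|apply Cmod_triangle]|].
  rewrite Cmod_R, Rabs_pos_eq by lra.
  rewrite Rmult_plus_distr_l; apply Rplus_le_compat_l.
  apply Rle_trans with ((Cmod (z - a) + 1) * (2 * e)); [nra|].
  right; unfold e; field; lra.
Qed.

(** * Semigroups with Denjoy-Wolff point 1 *)

(** Squaring and expanding |h z - h a|^2 and |z - a|^2 cancels the common product and leaves the
    factor 1 - |a|^2 exposed. In this form [a] can be sent to the circle. *)
Lemma half_plane_pick_sqr (h : C -> C) (a z : C) :
  holomorphic_on_disk h -> (forall w, in_disk w -> 0 <= Re (h w)) ->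
  in_disk a -> in_disk z ->
  (1 - Cmod z ^ 2) * (1 - Cmod a ^ 2) * Cmod (h z + Cconj (h a)) ^ 2
  <= 4 * Re (h z) * Re (h a) * Cmod (1 - Cconj a * z) ^ 2.
Proof.
intros Hh Hpos Ha Hz.
assert (H := half_plane_pick h a z Hh Hpos Ha Hz).
assert (H2 : (Cmod (h z - h a) * Cmod (1 - Cconj a * z)) ^ 2
   <= (Cmod (z - a) * Cmod (h z + Cconj (h a))) ^ 2).
{ apply pow_incr; split; [apply Rmult_le_pos; apply Cmod_ge_0|exact H]. }
rewrite !Rpow_mult_distr in H2.
assert (E1 : Cmod (h z - h a) ^ 2 = Cmod (h z + Cconj (h a)) ^ 2 - 4 * Re (h z) * Re (h a)).
{ rewrite !Cmod2_alt; destruct (h z), (h a); unfold Re, Im; simpl; ring. }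
assert (E2 : Cmod (z - a) ^ 2 =
  Cmod (1 - Cconj a * z) ^ 2 - (1 - Cmod z ^ 2) * (1 - Cmod a ^ 2)).
{ rewrite !Cmod2_alt; destruct z, a; unfold Re, Im; simpl; ring. }
rewrite E1, E2 in H2.
assert (P1 := pow2_ge_0 (Cmod (1 - Cconj a * z)));
assert (P2 := pow2_ge_0 (Cmod (h z + Cconj (h a)))). lra.
Qed.

Lemma one_minus_neq_0 (z : C) : in_disk z -> (1 - z)%C <> RtoC 0.
Proof.
intros Hz E; unfold in_disk in Hz.
replace z with (RtoC 1) in Hz; [rewrite Cmod_1 in Hz; lra|].
replace (RtoC 1) with ((1 - z) + z)%C by ring; rewrite E; ring.
Qed.

Lemma one_minus_Cmod2_pos (z : C) : in_disk z -> 0 < 1 - Cmod z ^ 2.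
Proof. unfold in_disk; intros Hz; generalize (Cmod_ge_0 z); nra. Qed.

Lemma cayley_Re (x : C) : x <> RtoC 1 ->
  Re ((1 + x) / (1 - x)) * Cmod (1 - x) ^ 2 = 1 - Cmod x ^ 2.
Proof.
intros Hx; assert (H : (1 - x)%C <> RtoC 0).
{ intros E; apply Hx; replace x with (1 - (1 - x))%C by ring; rewrite E; ring. }
apply Cmod_gt_0 in H; assert (Hp : 0 < Cmod (1 - x) ^ 2) by (apply pow_lt, H).
rewrite !Cmod2_alt in *; destruct x as [x y]; unfold Re, Im in *; simpl in *.
field; nra.
Qed.

(** The half-plane inequality for the Cayley transform (1 + phi)/(1 - phi); the denominators |1 -
    phi z|^2 |1 - phi a|^2 occur on both sides and cancel. *)
Lemma schwarz_pick (phi : C -> C) (a z : C) :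
  holomorphic_on_disk phi -> (forall w, in_disk w -> in_disk (phi w)) ->
  in_disk a -> in_disk z ->
  (1 - Cmod z ^ 2) * (1 - Cmod a ^ 2) * Cmod (1 - Cconj (phi a) * phi z) ^ 2
  <= (1 - Cmod (phi z) ^ 2) * (1 - Cmod (phi a) ^ 2) * Cmod (1 - Cconj a * z) ^ 2.
Proof.
intros Hphi Hself Ha Hz.
assert (Hne : forall w, in_disk w -> phi w <> RtoC 1).
{ intros w Hw E; apply Hself in Hw; unfold in_disk in Hw; rewrite E, Cmod_1 in Hw; lra. }
assert (Hre := fun w Hw => cayley_Re (phi w) (Hne w Hw)).
assert (H := half_plane_pick_sqr (fun w => (1 + phi w) / (1 - phi w))%C a z).
cbv beta in H.
assert (Na := one_minus_neq_0 _ (Hself a Ha)); assert (Nz := one_minus_neq_0 _ (Hself z Hz)).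
assert (Da : 0 < Cmod (1 - phi a) ^ 2) by (apply pow_lt, Cmod_gt_0, Na).
assert (Dz : 0 < Cmod (1 - phi z) ^ 2) by (apply pow_lt, Cmod_gt_0, Nz).
assert (E : Cmod ((1 + phi z) / (1 - phi z) + Cconj ((1 + phi a) / (1 - phi a))) ^ 2
   * (Cmod (1 - phi z) ^ 2 * Cmod (1 - phi a) ^ 2)
   = 4 * Cmod (1 - Cconj (phi a) * phi z) ^ 2).
{ assert (Nc : (1 - Cconj (phi a))%C <> RtoC 0).
  { intros e; apply Na; rewrite <- (Cconj_conj (1 - phi a)), Cminus_conj.
    replace (Cconj 1) with (RtoC 1) by (unfold Cconj, RtoC; simpl; f_equal; ring).
    rewrite e; unfold Cconj, RtoC; simpl; f_equal; ring. }
  replace (Cconj ((1 + phi a) / (1 - phi a)))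
    with ((1 + Cconj (phi a)) / (1 - Cconj (phi a)))%C.
  2:{ rewrite Cdiv_conj, Cplus_conj, Cminus_conj by exact Na.
      replace (Cconj 1) with (RtoC 1) by (unfold Cconj, RtoC; simpl; f_equal; ring).
      reflexivity. }
  replace ((1 + phi z) / (1 - phi z) + (1 + Cconj (phi a)) / (1 - Cconj (phi a)))%C
    with (2 * (1 - Cconj (phi a) * phi z) / ((1 - phi z) * (1 - Cconj (phi a))))%C
    by (field; auto).
  rewrite Cmod_div, !Cmod_mult by (apply Cmult_neq_0; assumption).
  replace (Cmod (1 - Cconj (phi a))) with (Cmod (1 - phi a)).
  2:{ rewrite <- (Cmod_conj (1 - phi a)), Cminus_conj.
      do 2 f_equal; unfold Cconj, RtoC; simpl; f_equal; ring. }
  rewrite Cmod_R, Rabs_pos_eq by lra. field.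
  split; apply Rgt_not_eq, Cmod_gt_0; assumption. }
apply (Rmult_le_reg_r (4 * / (Cmod (1 - phi z) ^ 2 * Cmod (1 - phi a) ^ 2))).
{ apply Rmult_lt_0_compat; [lra|apply Rinv_0_lt_compat, Rmult_lt_0_compat; assumption]. }
match goal with |- ?L <= ?R =>
  assert (EL : L = (1 - Cmod z ^ 2) * (1 - Cmod a ^ 2) *
     Cmod ((1 + phi z) / (1 - phi z) + Cconj ((1 + phi a) / (1 - phi a))) ^ 2);
  [|assert (ER : R = 4 * Re ((1 + phi z) / (1 - phi z)) * Re ((1 + phi a) / (1 - phi a))
       * Cmod (1 - Cconj a * z) ^ 2)] end.
{ match goal with |- _ = _ * ?X =>
   replace X with (4 * Cmod (1 - Cconj (phi a) * phi z) ^ 2 /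
     (Cmod (1 - phi z) ^ 2 * Cmod (1 - phi a) ^ 2))
     by (rewrite <- E; field; split; apply Rgt_not_eq, Cmod_gt_0; assumption) end.
  field; split; apply Rgt_not_eq, Cmod_gt_0; assumption. }
{ rewrite <- !Hre by assumption. field; split; apply Rgt_not_eq, Cmod_gt_0; assumption. }
rewrite EL, ER; apply H; try assumption.
- intros w Hw; apply cdiff_div; [apply one_minus_neq_0, Hself, Hw| |].
  + apply cdiff_plus; [apply cdiff_const|apply Hphi, Hw].
  + apply cdiff_minus; [apply cdiff_const|apply Hphi, Hw].
- intros w Hw; assert (Hp : 0 < Cmod (1 - phi w) ^ 2)
    by (apply pow_lt, Cmod_gt_0, one_minus_neq_0, Hself, Hw).
  assert (h1 := Hre w Hw); assert (h2 := one_minus_Cmod2_pos _ (Hself w Hw)).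
  rewrite <- h1 in h2.
  destruct (Rle_lt_dec 0 (Re ((1 + phi w) / (1 - phi w)))) as [|Hl]; [assumption|].
  exfalso; nra.
Qed.

(** * Horocycle invariance and the sign condition on the generator *)

Lemma filterlim_C_eps (T : Type) (G : (T -> Prop) -> Prop) (g : T -> C) (l : C) :
  Filter G -> filterlim g G (locally l) ->
  forall eps : R, 0 < eps -> G (fun x => Cmod (g x - l) < eps).
Proof.
intros FG H eps He.
exact (H _ (@locally_ball_norm C_AbsRing C_NormedModule l (mkposreal eps He))).
Qed.

(** Both passages to the boundary gather all their errors in one number [e], as polynomial
    inequalities valid for small e > 0, and finish here. *)
Lemma le_limit_0 (g h : R -> R) (e0 : R) :
  0 < e0 -> continuous g 0 -> continuous h 0 ->
  (forall e, 0 < e < e0 -> g e <= h e) -> g 0 <= h 0.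
Proof.
intros He0 Hg Hh H.
apply (filterlim_le (F := at_right 0) g h (g 0) (h 0)).
- exists (mkposreal e0 He0); intros e Hb Hp; apply H; split; [exact Hp|].
  unfold ball in Hb; simpl in Hb; unfold AbsRing_ball, abs, minus, plus, opp in Hb; simpl in Hb.
  apply Rabs_lt_between in Hb; lra.
- eapply filterlim_filter_le_1; [apply filter_le_within|exact Hg].
- eapply filterlim_filter_le_1; [apply filter_le_within|exact Hh].
Qed.

Section Semigroup.
Variables (F : R -> C -> C) (f : C -> C).
Hypothesis HF : is_semigroup F.
Hypothesis HDW : is_Denjoy_Wolff_point F (RtoC 1).

Lemma in_disk_0 : in_disk (RtoC 0).
Proof. unfold in_disk; rewrite Cmod_0; lra. Qed.

Lemma orbit_limit (z : C) (eps : R) : in_disk z -> 0 < eps ->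
  exists S, 0 <= S /\ forall s, S <= s -> Cmod (F s z - 1) < eps.
Proof.
intros Hz He; destruct HDW as [_ H].
destruct (filterlim_C_eps _ _ _ _ _ (H z Hz) eps He) as [M HM].
exists (Rmax 0 (M + 1)); split; [apply Rmax_l|].
intros s Hs; apply HM; generalize (Rmax_r 0 (M + 1)); lra.
Qed.

(* Otherwise [Cmod (F s 0)] would stay below [Cmod (F S 0)] along
   [s = S + n t], while it tends to [1]. *)
Lemma orbit_modulus_recurrence (t S : R) : 0 <= t -> 0 <= S ->
  exists s, S <= s /\ Cmod (F s 0) <= Cmod (F (t + s) 0).
Proof.
intros Ht HS.
destruct (excluded_middle_informative
  (exists s, S <= s /\ Cmod (F s 0) <= Cmod (F (t + s) 0))) as [|Hn]; [assumption|exfalso].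
assert (Hdec : forall s, S <= s -> Cmod (F (t + s) 0) < Cmod (F s 0)).
{ intros s Hs; apply Rnot_le_lt; intros Hle; apply Hn; exists s; auto. }
destruct Ht as [Ht|<-].
2:{ specialize (Hdec S (Rle_refl S)); rewrite Rplus_0_l in Hdec; lra. }
assert (Hin : Cmod (F S 0) < 1) by (apply (semigroup_self F HF); [exact HS|apply in_disk_0]).
assert (Hseq : forall n, Cmod (F (INR n * t + S) 0) <= Cmod (F S 0)).
{ intros n; induction n as [|n IH].
  - simpl; rewrite Rmult_0_l, Rplus_0_l; lra.
  - rewrite S_INR; replace ((INR n + 1) * t + S) with (t + (INR n * t + S)) by ring.
    apply Rle_trans with (Cmod (F (INR n * t + S) 0)); [|exact IH].
    left; apply Hdec. generalize (pos_INR n); nra. }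
(* With this tolerance every late orbit point has modulus above that of F S 0, contradicting
   [Hseq]. *)
destruct (orbit_limit (RtoC 0) (1 - Cmod (F S 0)) in_disk_0) as [T [HT H]]; [lra|].
destruct (INR_unbounded (T / t)) as [n Hn'].
apply (Rmult_lt_compat_r t) in Hn'; [|exact Ht].
unfold Rdiv in Hn'; rewrite Rmult_assoc, Rinv_l, Rmult_1_r in Hn' by lra.
specialize (H (INR n * t + S)); specialize (Hseq n).
assert (H' := H ltac:(lra)).
assert (Htri := Cmod_triangle (F (INR n * t + S) 0) (- (F (INR n * t + S) 0 - 1))).
replace (F (INR n * t + S) 0 + - (F (INR n * t + S) 0 - 1))%C with (RtoC 1) in Htri by ring.
rewrite Cmod_1, Cmod_opp in Htri. lra.
Qed.

(** Schwarz-Pick for [F t] between [z] and an orbit point a = F s 0, with image b = F t a. Both [a]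
    and [b] tend to 1, and the recurrence lemma supplies late times [s] with |a| <= |b|. There the
    ratio (1 - |b|^2)/(1 - |a|^2) is at most 1, so no dilation factor appears in the limit. *)
Lemma horocycle_invariance (t : R) (z : C) : 0 <= t -> in_disk z ->
  (1 - Cmod z ^ 2) * Cmod (1 - F t z) ^ 2 <= (1 - Cmod (F t z) ^ 2) * Cmod (1 - z) ^ 2.
Proof.
intros Ht Hz.
assert (Hx : in_disk (F t z)) by (apply (semigroup_self F HF); assumption).
set (x := F t z) in *.
assert (Hp : 0 < Cmod (1 - x)) by (apply Cmod_gt_0, one_minus_neq_0, Hx).
assert (HA := one_minus_Cmod2_pos z Hz); assert (HB := one_minus_Cmod2_pos x Hx).
replace (Cmod (1 - x)) with (Cmod (1 - x) - 0) by ring.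
replace (Cmod (1 - z)) with (Cmod (1 - z) + 0) by ring.
apply (le_limit_0 (fun e => (1 - Cmod z ^ 2) * (Cmod (1 - x) - e) ^ 2)
  (fun e => (1 - Cmod x ^ 2) * (Cmod (1 - z) + e) ^ 2) (Cmod (1 - x))).
- exact Hp.
- apply (ex_derive_continuous (V := R_NormedModule)); auto_derive; auto.
- apply (ex_derive_continuous (V := R_NormedModule)); auto_derive; auto.
- intros e He.
  destruct (orbit_limit (RtoC 0) e in_disk_0 (proj1 He)) as [S [HS Hlim]].
  destruct (orbit_modulus_recurrence t S Ht HS) as [s [Hs Hmod]].
  assert (Hs0 : 0 <= s) by lra.
  set (a := F s (RtoC 0)) in *.
  assert (Ha : in_disk a) by (apply (semigroup_self F HF); [exact Hs0|apply in_disk_0]).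
  assert (Hb : F (t + s) (RtoC 0) = F t a)
    by (apply (semigroup_add F HF); auto; apply in_disk_0).
  assert (Hbl := Hlim (t + s) ltac:(lra)).
  rewrite Hb in Hmod, Hbl. assert (Hal : Cmod (a - 1) < e) by (apply Hlim, Hs).
  assert (Hbd : in_disk (F t a)) by (apply (semigroup_self F HF); assumption).
  set (b := F t a) in *.
  assert (SP := schwarz_pick (F t) a z (semigroup_holo F HF t Ht)
    (fun w => semigroup_self F HF t w Ht) Ha Hz).
  fold x b in SP.
  assert (Pa := one_minus_Cmod2_pos a Ha); assert (Pb := one_minus_Cmod2_pos b Hbd).
  assert (Hab : 1 - Cmod b ^ 2 <= 1 - Cmod a ^ 2)
    by (assert (Cmod a ^ 2 <= Cmod b ^ 2);
        [apply pow_incr; split; [apply Cmod_ge_0|exact Hmod]|lra]).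
  assert (Hdist : forall c w, in_disk w -> Cmod (c - 1) < e ->
     Cmod (1 - w) - e <= Cmod (1 - Cconj c * w) <= Cmod (1 - w) + e).
  { intros c w Hw Hc.
    assert (Hk : Cmod ((Cconj c - 1) * w) <= e).
    { rewrite Cmod_mult.
      replace (Cconj c - 1)%C with (Cconj (c - 1))
        by (rewrite Cminus_conj; f_equal; unfold Cconj, RtoC; simpl; f_equal; ring).
      rewrite Cmod_conj; unfold in_disk in Hw.
      generalize (Cmod_ge_0 w) (Cmod_ge_0 (c - 1)); nra. }
    assert (T1 := Cmod_triangle (1 - Cconj c * w) ((Cconj c - 1) * w)).
    assert (T2 := Cmod_triangle (1 - w) (- ((Cconj c - 1) * w))).
    replace (1 - Cconj c * w + (Cconj c - 1) * w)%C with (1 - w)%C in T1 by ring.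
    replace (1 - w + - ((Cconj c - 1) * w))%C with (1 - Cconj c * w)%C in T2 by ring.
    rewrite Cmod_opp in T2. lra. }
  destruct (Hdist b x Hx Hbl) as [D1 _]; destruct (Hdist a z Hz Hal) as [_ D2].
  assert (Q1 : (Cmod (1 - x) - e) ^ 2 <= Cmod (1 - Cconj b * x) ^ 2)
    by (apply pow_incr; lra).
  assert (Q2 : Cmod (1 - Cconj a * z) ^ 2 <= (Cmod (1 - z) + e) ^ 2)
    by (apply pow_incr; split; [apply Cmod_ge_0|exact D2]).
  apply (Rmult_le_reg_l (1 - Cmod a ^ 2)); [exact Pa|].
  apply Rle_trans with ((1 - Cmod z ^ 2) * (1 - Cmod a ^ 2) * Cmod (1 - Cconj b * x) ^ 2).
  { replace ((1 - Cmod a ^ 2) * ((1 - Cmod z ^ 2) * (Cmod (1 - x) - e) ^ 2))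
      with ((1 - Cmod z ^ 2) * (1 - Cmod a ^ 2) * (Cmod (1 - x) - e) ^ 2) by ring.
    apply Rmult_le_compat_l; [|exact Q1]. apply Rmult_le_pos; lra. }
  eapply Rle_trans; [exact SP|].
  replace ((1 - Cmod a ^ 2) * ((1 - Cmod x ^ 2) * (Cmod (1 - z) + e) ^ 2))
      with ((1 - Cmod x ^ 2) * (1 - Cmod a ^ 2) * (Cmod (1 - z) + e) ^ 2) by ring.
  apply Rmult_le_compat; [|apply pow2_ge_0| |exact Q2].
  + apply Rmult_le_pos; lra.
  + apply Rmult_le_compat_l; lra.
Qed.

Hypothesis Hgen : is_generator F f.

Lemma generator_eps (z : C) (eps : R) : in_disk z -> 0 < eps ->
  exists delta, 0 < delta /\ forall t, 0 < t < delta ->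
    Cmod (/ t * (z - F t z) - f z) < eps.
Proof.
intros Hz He; destruct Hgen as [_ H].
destruct (filterlim_C_eps _ _ _ _ _ (H z Hz) eps He) as [d Hd].
exists d; split; [apply cond_pos|]; intros t Ht.
rewrite <- RtoC_inv by lra.
apply Hd; [|lra].
unfold ball; simpl; unfold AbsRing_ball, abs, minus, plus, opp; simpl.
rewrite Rabs_pos_eq; lra.
Qed.

Lemma berkson_porta_sign (z : C) : in_disk z ->
  Re (f z * Cconj ((1 - z) * (1 - z))) <= 0.
Proof.
intros Hz; apply le_epsilon; intros eps He.
assert (Hm : 0 < Cmod ((1 - z) * (1 - z)))
  by (apply Cmod_gt_0, Cmult_neq_0; apply one_minus_neq_0, Hz).
destruct (generator_eps z (eps / Cmod ((1 - z) * (1 - z))) Hz) as [d [Hd H]].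
{ apply Rdiv_lt_0_compat; assumption. }
assert (Ht : 0 < d / 2) by lra. specialize (H (d / 2) ltac:(lra)).
set (t := d / 2) in *; assert (HI := horocycle_invariance t z (Rlt_le _ _ Ht) Hz).
set (D := (/ t * (z - F t z))%C) in *.
assert (Ex : F t z = (z - t * D)%C).
{ unfold D; field. apply Cmod_gt_0; rewrite Cmod_R, Rabs_pos_eq; lra. }
rewrite Ex in HI.
assert (HD : Re (D * Cconj ((1 - z) * (1 - z))) <= 0).
{ assert (Hz1 : Re z < 1).
  { unfold in_disk in Hz; generalize (re_le_Cmod z); intros h; apply Rabs_le_between in h; lra. }
  (* An exact expansion: the term quadratic in [t] has a favourable sign, so the inequality already
     holds for the difference quotient [D], and only D -> f z remains. *)
  assert (E : (1 - Cmod (z - t * D) ^ 2) * Cmod (1 - z) ^ 2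
    - (1 - Cmod z ^ 2) * Cmod (1 - (z - t * D)) ^ 2
    = - 2 * t * (Re (D * Cconj ((1 - z) * (1 - z))) + t * (1 - Re z) * Cmod D ^ 2)).
  { rewrite !Cmod2_alt; destruct z as [z1 z2], D as [d1 d2]; unfold Re, Im; simpl; ring. }
  assert (P : 0 <= t * (1 - Re z) * Cmod D ^ 2)
    by (apply Rmult_le_pos; [apply Rmult_le_pos; lra|apply pow2_ge_0]).
  nra. }
replace (f z) with (D - (D - f z))%C by ring.
assert (E2 : Re ((D - (D - f z)) * Cconj ((1 - z) * (1 - z))) =
  Re (D * Cconj ((1 - z) * (1 - z))) - Re ((D - f z) * Cconj ((1 - z) * (1 - z)))).
{ unfold Re; simpl; ring. }
rewrite E2.
assert (B := re_le_Cmod ((D - f z) * Cconj ((1 - z) * (1 - z)))).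
rewrite Cmod_mult, Cmod_conj in B.
apply (Rmult_lt_compat_r _ _ _ Hm) in H.
unfold Rdiv in H; rewrite Rmult_assoc, Rinv_l, Rmult_1_r in H by lra.
apply Rabs_le_between in B. lra.
Qed.

(** p = f/(1 - z)^2 has real part at most 0. If it vanishes at [z0], the Pick inequality for -p
    reads |p| |1 - conj z0 z| <= |z - z0| |p|, and |z - z0| < |1 - conj z0 z| forces p = 0. *)
Lemma generator_zero_everywhere (z0 z : C) :
  in_disk z0 -> f z0 = RtoC 0 -> in_disk z -> f z = RtoC 0.
Proof.
intros Hz0 H0 Hz.
assert (Hsq : forall w, in_disk w -> ((1 - w) * (1 - w))%C <> RtoC 0)
  by (intros w Hw; apply Cmult_neq_0; apply one_minus_neq_0, Hw).
assert (H := half_plane_pick (fun w => - (f w / ((1 - w) * (1 - w))))%C z0 z).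
cbv beta in H; rewrite H0 in H.
set (p := (f z / ((1 - z) * (1 - z)))%C) in *.
replace (0 / ((1 - z0) * (1 - z0)))%C with (RtoC 0) in H by (unfold Cdiv; ring).
replace (- p - - 0)%C with (- p)%C in H by ring.
replace (- p + Cconj (- 0))%C with (- p)%C in H
  by (unfold Cconj, Copp, Cplus, RtoC; destruct p; simpl; f_equal; ring).
rewrite Cmod_opp in H.
assert (Hp : p = RtoC 0).
{ apply Cmod_eq_0.
  assert (H' : Cmod p * Cmod (1 - Cconj z0 * z) <= Cmod (z - z0) * Cmod p).
  { apply H; try assumption.
    - intros w Hw; apply cdiff_opp, cdiff_div; [apply Hsq, Hw|apply Hgen, Hw|].
      apply one_minus_sqr_cdiff.
    - intros w Hw.
      assert (B := berkson_porta_sign w Hw).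
      assert (Hd := Hsq w Hw); set (D := ((1 - w) * (1 - w))%C) in *.
      assert (Hm : 0 < Cmod D ^ 2) by (apply pow_lt, Cmod_gt_0, Hd).
      replace (- (f w / D))%C with (RtoC (/ Cmod D ^ 2) * - (f w * Cconj D))%C.
      + replace (Re (RtoC (/ Cmod D ^ 2) * - (f w * Cconj D)))
          with (/ Cmod D ^ 2 * - Re (f w * Cconj D)) by (unfold Re; simpl; ring).
        apply Rmult_le_pos; [left; apply Rinv_0_lt_compat, Hm|lra].
      + assert (HDc : Cconj D <> RtoC 0).
        { apply Cmod_gt_0; rewrite Cmod_conj; apply Cmod_gt_0, Hd. }
        rewrite RtoC_inv by lra. rewrite Cmod2_conj; field; auto. }
  assert (E2 : Cmod (z - z0) ^ 2 =
    Cmod (1 - Cconj z0 * z) ^ 2 - (1 - Cmod z ^ 2) * (1 - Cmod z0 ^ 2)).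
  { rewrite !Cmod2_alt; destruct z, z0; unfold Re, Im; simpl; ring. }
  assert (Q1 := one_minus_Cmod2_pos z Hz); assert (Q2 := one_minus_Cmod2_pos z0 Hz0).
  assert (Q3 := Rmult_lt_0_compat _ _ Q1 Q2).
  assert (Cmod (z - z0) < Cmod (1 - Cconj z0 * z)).
  { apply Rsqr_incrst_0; try apply Cmod_ge_0; unfold Rsqr; nra. }
  generalize (Cmod_ge_0 p); nra. }
replace (f z) with (p * ((1 - z) * (1 - z)))%C by (unfold p; field; apply one_minus_neq_0, Hz).
rewrite Hp; ring.
Qed.

End Semigroup.

(** The generator controls orbits only through right derivatives, so the mean value theorem is
    replaced by a supremum of good times: continuity includes the supremum, and the right slope
    pushes beyond it. *)
Lemma right_slope_bound (G : R -> R) (eps : R) :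
  G 0 <= 0 ->
  (forall t, 0 <= t -> exists d, 0 < d /\ forall u, t < u < t + d ->
     G u <= G t + eps * (u - t)) ->
  (forall t eta, 0 <= t -> 0 < eta -> exists d, 0 < d /\
     forall u, 0 <= u -> Rabs (u - t) < d -> Rabs (G u - G t) < eta) ->
  0 <= eps -> forall T, 0 <= T -> G T <= eps * T.
Proof.
intros H0 Hr Hc Heps T HT.
destruct (completeness (fun s => 0 <= s <= T /\ forall u, 0 <= u <= s -> G u <= eps * u))
  as [s [Hub Hlub]].
{ exists T; intros s Hs; apply Hs. }
{ exists 0; split; [lra|]; intros u Hu; replace u with 0 by lra; lra. }
assert (Hs0 : 0 <= s).
{ apply Hub; split; [lra|]; intros u Hu; replace u with 0 by lra; lra. }
assert (HsT : s <= T) by (apply Hlub; intros x Hx; apply Hx).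
assert (Hbelow : forall u, 0 <= u < s -> G u <= eps * u).
{ intros u Hu; apply Rnot_lt_le; intros Hlt.
  assert (s <= u); [|lra].
  apply Hlub; intros x [Hx Hx'].
  apply Rnot_lt_le; intros Hux; specialize (Hx' u ltac:(lra)); lra. }
assert (Hs : G s <= eps * s).
{ destruct Hs0 as [Hs0|<-]; [|lra].
  apply le_epsilon; intros eta Heta.
  destruct (Hc s eta (Rlt_le _ _ Hs0) Heta) as [d [Hd H]].
  set (u := Rmax 0 (s - d / 2)).
  assert (Hu : 0 <= u < s) by (split; [apply Rmax_l|apply Rmax_lub_lt; lra]).
  assert (Hu' : s - d / 2 <= u) by apply Rmax_r.
  specialize (H u (proj1 Hu)); specialize (Hbelow u Hu).
  assert (H' : Rabs (u - s) < d) by (apply Rabs_lt_between; lra).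
  specialize (H H'); apply Rabs_lt_between in H. nra. }
destruct HsT as [HsT|<-]; [exfalso|exact Hs].
destruct (Hr s Hs0) as [d [Hd H]].
set (s' := Rmin T (s + d / 2)).
assert (h1 : s' <= T) by apply Rmin_l.
assert (h2 : s' <= s + d / 2) by apply Rmin_r.
assert (h3 : s < s') by (apply Rmin_glb_lt; lra).
assert (s' <= s); [|lra].
apply Hub; split; [lra|]; intros u Hu.
destruct (Rtotal_order u s) as [Hl|[->|Hg]].
- apply Hbelow; lra.
- exact Hs.
- specialize (H u ltac:(lra)); lra.
Qed.

(** If f vanishes at one point it vanishes throughout the disk, so the orbit of 0 has right
    derivative 0 at all times and is constant, which is incompatible with its convergence to 1. *)
Lemma generator_neq_0 (F : R -> C -> C) (f : C -> C) (z : C) :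
  is_semigroup F -> is_generator F f -> is_Denjoy_Wolff_point F (RtoC 1) ->
  in_disk z -> f z <> RtoC 0.
Proof.
intros HF Hg HDW Hz Hfz.
assert (Hf0 : forall w, in_disk w -> f w = RtoC 0)
  by (intros w Hw; exact (generator_zero_everywhere F f HF HDW Hg z w Hz Hfz Hw)).
assert (Hin : forall t, 0 <= t -> in_disk (F t (RtoC 0)))
  by (intros t Ht; apply (semigroup_self F HF); [exact Ht|apply in_disk_0]).
assert (Hconst : forall T, 0 <= T -> Cmod (F T (RtoC 0) - F 0 (RtoC 0)) <= 0).
{ intros T HT; apply le_epsilon; intros eps He.
  rewrite Rplus_0_l.
  assert (HT1 : 0 < eps / (T + 1)) by (apply Rdiv_lt_0_compat; lra).
  apply Rle_trans with (eps / (T + 1) * T).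
  2:{ apply (Rmult_le_reg_r (T + 1)); [lra|].
      replace (eps / (T + 1) * T * (T + 1)) with (eps * T) by (field; lra). nra. }
  apply (right_slope_bound (fun t => Cmod (F t (RtoC 0) - F 0 (RtoC 0)))); [|  | |lra|exact HT].
  - unfold Cminus; rewrite Cplus_opp_r, Cmod_0; lra.
  - intros t Ht.
    destruct (generator_eps F f Hg (F t (RtoC 0)) (eps / (T + 1)) (Hin t Ht) HT1)
      as [d [Hd H]].
    exists d; split; [exact Hd|]; intros u Hu.
    specialize (H (u - t) ltac:(lra)).
    (* The semigroup law carries the derivative at time 0 over to time [t], with F t 0 as starting
       point. *)
    assert (Eu : F u (RtoC 0) = F (u - t) (F t (RtoC 0))).
    { rewrite <- (semigroup_add F HF); [f_equal; ring|lra|exact Ht|apply in_disk_0]. }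
    rewrite <- Eu, Hf0 in H by (apply Hin, Ht).
    assert (Hn : RtoC (u - t) <> RtoC 0)
      by (apply Cmod_gt_0; rewrite Cmod_R, Rabs_pos_eq; lra).
    replace (F u 0 - F 0 0)%C
      with ((F t 0 - F 0 0) + - (RtoC (u - t) * (/ RtoC (u - t) * (F t 0 - F u 0) - 0)))%C
      by (field; exact Hn).
    eapply Rle_trans; [apply Cmod_triangle|].
    rewrite Cmod_opp, Cmod_mult, Cmod_R, (Rabs_pos_eq (u - t)) by lra.
    apply Rplus_le_compat_l; rewrite Rmult_comm; apply Rmult_le_compat_r; lra.
  - intros t eta Ht Heta.
    destruct (filterlim_C_eps _ _ _ _ _ (semigroup_cont F HF (RtoC 0) t in_disk_0 Ht) eta Heta)
      as [d Hd].
    exists d; split; [apply cond_pos|]; intros u Hu Hut.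
    specialize (Hd u Hut Hu).
    eapply Rle_lt_trans; [|exact Hd].
    assert (T1 := Cmod_triangle (F u (RtoC 0) - F t (RtoC 0)) (F t (RtoC 0) - F 0 (RtoC 0))).
    assert (T2 := Cmod_triangle (- (F u (RtoC 0) - F t (RtoC 0))) (F u (RtoC 0) - F 0 (RtoC 0))).
    rewrite Cmod_opp in T2.
    replace (F u 0 - F t 0 + (F t 0 - F 0 0))%C with (F u 0 - F 0 0)%C in T1 by ring.
    replace (- (F u 0 - F t 0) + (F u 0 - F 0 0))%C with (F t 0 - F 0 0)%C in T2 by ring.
    apply Rabs_le_between; lra. }
destruct (orbit_limit F HDW (RtoC 0) 1 in_disk_0 Rlt_0_1) as [S [HS H]].
specialize (H S (Rle_refl S)); specialize (Hconst S HS).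
rewrite (semigroup_zero F HF) in Hconst by apply in_disk_0.
assert (E : F S (RtoC 0) = RtoC 0).
{ replace (F S 0) with (F S 0 - 0)%C by ring.
  apply Cmod_eq_0; generalize (Cmod_ge_0 (F S 0 - 0)); lra. }
rewrite E in H; replace (0 - 1)%C with (- (1))%C in H by ring.
rewrite Cmod_m1 in H; lra.
Qed.

(** * Boundary atoms *)

Definition radial_lim (g : R -> C) (l : C) : Prop :=
  forall eps, 0 < eps -> exists delta, 0 < delta /\
    forall r, 1 - delta < r < 1 -> Cmod (g r - l) < eps.

Lemma radial_lim_ext (g h : R -> C) (l : C) :
  (forall r, 0 < r < 1 -> g r = h r) -> radial_lim g l -> radial_lim h l.
Proof.
intros E H eps He; destruct (H eps He) as [d [Hd Hg]].
exists (Rmin d 1); split; [apply Rmin_glb_lt; lra|].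
intros r Hr; generalize (Rmin_l d 1) (Rmin_r d 1); intros.
rewrite <- E by lra; apply Hg; lra.
Qed.

Lemma radial_lim_comp (phi : C -> C) (g : R -> C) (l : C) :
  cdiff phi l -> radial_lim g l -> radial_lim (fun r => phi (g r)) (phi l).
Proof.
intros Hphi Hg eps He.
destruct (cdiff_continuous phi l Hphi eps He) as [d [Hd H]].
destruct (Hg d Hd) as [d' [Hd' H']].
exists d'; split; [exact Hd'|]; intros r Hr; apply H, H', Hr.
Qed.

Lemma radial_lim_id : radial_lim RtoC (RtoC 1).
Proof.
intros eps He; exists eps; split; [exact He|]; intros r Hr.
rewrite <- RtoC_minus, Cmod_R; apply Rabs_lt_between; lra.
Qed.

Lemma radial_lim_plus (g h : R -> C) (l m : C) :
  radial_lim g l -> radial_lim h m -> radial_lim (fun r => g r + h r)%C (l + m)%C.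
Proof.
intros Hg Hh eps He.
destruct (Hg (eps / 2)) as [d1 [Hd1 H1]]; [lra|].
destruct (Hh (eps / 2)) as [d2 [Hd2 H2]]; [lra|].
exists (Rmin d1 d2); split; [apply Rmin_glb_lt; assumption|].
intros r Hr; generalize (Rmin_l d1 d2) (Rmin_r d1 d2); intros.
replace (g r + h r - (l + m))%C with ((g r - l) + (h r - m))%C by ring.
eapply Rle_lt_trans; [apply Cmod_triangle|].
specialize (H1 r ltac:(lra)); specialize (H2 r ltac:(lra)); lra.
Qed.

Lemma radial_lim_mult (g h : R -> C) (l m : C) :
  radial_lim g l -> radial_lim h m -> radial_lim (fun r => g r * h r)%C (l * m)%C.
Proof.
intros Hg Hh eps He.
set (K := Cmod l + Cmod m + 1).
assert (pl := Cmod_ge_0 l); assert (pm := Cmod_ge_0 m).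
assert (HK : 0 < K) by (unfold K; lra).
set (e := Rmin 1 (eps / K)).
assert (He' : 0 < e) by (apply Rmin_glb_lt; [lra|apply Rdiv_lt_0_compat; assumption]).
assert (e1 : e <= 1) by apply Rmin_l.
assert (e2 : e * K <= eps).
{ apply Rle_trans with (eps / K * K); [|right; field; lra].
  apply Rmult_le_compat_r; [lra|apply Rmin_r]. }
destruct (Hg e He') as [d1 [Hd1 H1]]; destruct (Hh e He') as [d2 [Hd2 H2]].
exists (Rmin d1 d2); split; [apply Rmin_glb_lt; assumption|].
intros r Hr; generalize (Rmin_l d1 d2) (Rmin_r d1 d2); intros.
specialize (H1 r ltac:(lra)); specialize (H2 r ltac:(lra)).
replace (g r * h r - l * m)%C
  with ((g r - l) * (h r - m) + (l * (h r - m) + (g r - l) * m))%C by ring.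
eapply Rle_lt_trans; [apply Cmod_triangle|].
eapply Rle_lt_trans; [apply Rplus_le_compat_l, Cmod_triangle|].
rewrite !Cmod_mult.
generalize (Cmod_ge_0 (g r - l)) (Cmod_ge_0 (h r - m)); intros.
unfold K in e2.
assert (Cmod (g r - l) * Cmod (h r - m) < e * 1) by (apply Rmult_le_0_lt_compat; lra).
assert (Cmod l * Cmod (h r - m) <= Cmod l * e) by (apply Rmult_le_compat_l; lra).
assert (Cmod (g r - l) * Cmod m <= e * Cmod m) by (apply Rmult_le_compat_r; lra).
lra.
Qed.

(* Half-plane Schwarz-Pick between [z] and [r zeta], rescaled by [1 - r] and
   passed to the limit [r -> 1]. *)
Lemma julia_boundary (q : C -> C) (zeta z : C) (m : R) :
  holomorphic_on_disk q -> (forall w, in_disk w -> 0 <= Re (q w)) ->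
  on_circle zeta -> 0 < m ->
  radial_lim (fun r => (1 - RtoC r) * q (RtoC r * zeta))%C (RtoC (2 * m)) ->
  in_disk z ->
  m * (1 - Cmod z ^ 2) <= Re (q z) * Cmod (1 - Cconj zeta * z) ^ 2.
Proof.
intros Hq Hpos Hzeta Hm Hrad Hz; unfold on_circle in Hzeta.
assert (Pz := one_minus_Cmod2_pos z Hz); assert (HR := Hpos z Hz).
set (R0 := Re (q z)) in *; set (D := Cmod (1 - Cconj zeta * z)).
assert (HD : 0 <= D) by apply Cmod_ge_0.
set (A := Cmod (q z)); assert (HA : 0 <= A) by apply Cmod_ge_0.
(* Below this bound 2m - e (1 + A) is positive, so the lower estimate [B1] may be squared. *)
assert (He0 : 0 < Rmin 1 (2 * m / (1 + A)))
  by (apply Rmin_glb_lt; [lra|apply Rdiv_lt_0_compat; lra]).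
assert (L := le_limit_0
  (fun e => (1 - Cmod z ^ 2) * (2 - e) * (2 * m - e * (1 + A)) ^ 2)
  (fun e => 4 * R0 * (2 * m + e) * (D + e) ^ 2) _ He0).
cbv beta in L.
assert (L' : (1 - Cmod z ^ 2) * (2 - 0) * (2 * m - 0 * (1 + A)) ^ 2
  <= 4 * R0 * (2 * m + 0) * (D + 0) ^ 2).
{ apply L; clear L.
  - apply (ex_derive_continuous (V := R_NormedModule)); auto_derive; auto.
  - apply (ex_derive_continuous (V := R_NormedModule)); auto_derive; auto.
  - intros e He.
    assert (e1 := Rlt_le_trans _ _ _ (proj2 He) (Rmin_l _ _)).
    assert (e2 := Rlt_le_trans _ _ _ (proj2 He) (Rmin_r _ _)).
    apply (Rmult_lt_compat_r (1 + A)) in e2; [|lra].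
    unfold Rdiv in e2; rewrite Rmult_assoc, Rinv_l, Rmult_1_r in e2 by lra.
    destruct (Hrad e (proj1 He)) as [d [Hd H]].
    set (s := Rmin (d / 2) (e / 2)).
    assert (Hs : 0 < s) by (apply Rmin_glb_lt; lra).
    assert (s1 : s <= d / 2) by apply Rmin_l; assert (s2 : s <= e / 2) by apply Rmin_r.
    specialize (H (1 - s) ltac:(lra)).
    replace (1 - RtoC (1 - s))%C with (RtoC s) in H by (rewrite RtoC_minus; ring).
    set (a := (RtoC (1 - s) * zeta)%C) in *.
    assert (Ham : Cmod a = 1 - s) by (unfold a; rewrite Cmod_mult, Hzeta, Cmod_R, Rabs_pos_eq; lra).
    assert (Ha : in_disk a) by (unfold in_disk; lra).
    assert (P := half_plane_pick_sqr q a z Hq Hpos Ha Hz).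
    rewrite Ham in P.
    set (Q := (RtoC s * q a)%C) in *.
    assert (EQ : s ^ 2 * Cmod (q z + Cconj (q a)) ^ 2 = Cmod (RtoC s * q z + Cconj Q) ^ 2).
    { replace (RtoC s * q z + Cconj Q)%C with (RtoC s * (q z + Cconj (q a)))%C.
      - rewrite Cmod_mult, Cmod_R, Rabs_pos_eq by lra; ring.
      - unfold Q; destruct (q z), (q a); unfold Cconj, Cmult, Cplus, RtoC; simpl; f_equal; ring. }
    assert (ER : Re Q = s * Re (q a)) by (unfold Q, Re; simpl; ring).
    (* Here s = 1 - r. One factor [s] comes from 1 - |a|^2 = s (2 - s) and another from multiplying
       through, so q(a) occurs only in the combination Q = s q(a), which is close to 2m. *)
    assert (P' : (1 - Cmod z ^ 2) * (2 - s) * Cmod (RtoC s * q z + Cconj Q) ^ 2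
       <= 4 * R0 * Re Q * Cmod (1 - Cconj a * z) ^ 2).
    { rewrite <- EQ, ER.
      apply (Rmult_le_compat_l s) in P; [|lra].
      fold R0 in P. eapply Rle_trans; [|eapply Rle_trans; [exact P|]]; right; ring. }
    assert (B1 : 2 * m - e * (1 + A) <= Cmod (RtoC s * q z + Cconj Q)).
    { assert (T1 := Cmod_triangle (RtoC s * q z + Cconj Q) (- (RtoC s * q z))).
      replace (RtoC s * q z + Cconj Q + - (RtoC s * q z))%C with (Cconj Q) in T1 by ring.
      rewrite Cmod_opp, Cmod_conj, Cmod_mult, Cmod_R, (Rabs_pos_eq s) in T1 by lra.
      assert (T2 := Cmod_triangle Q (- (Q - RtoC (2 * m)))).
      replace (Q + - (Q - RtoC (2 * m)))%C with (RtoC (2 * m)) in T2 by ring.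
      rewrite Cmod_opp, Cmod_R, Rabs_pos_eq in T2 by lra.
      fold A in T1; nra. }
    assert (B2 : Re Q <= 2 * m + e).
    { assert (T := re_le_Cmod (Q - RtoC (2 * m))); apply Rabs_le_between in T.
      replace (Re (Q - RtoC (2 * m))) with (Re Q - 2 * m) in T by (unfold Re; simpl; ring).
      lra. }
    assert (B3 : Cmod (1 - Cconj a * z) <= D + e).
    { replace (1 - Cconj a * z)%C with ((1 - Cconj zeta * z) + RtoC s * (Cconj zeta * z))%C.
      - eapply Rle_trans; [apply Cmod_triangle|]; fold D; apply Rplus_le_compat_l.
        rewrite !Cmod_mult, Cmod_conj, Hzeta, Cmod_R, Rabs_pos_eq by lra.
        unfold in_disk in Hz; generalize (Cmod_ge_0 z); nra.
      - unfold a; destruct zeta, z.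
        unfold Cconj, Cmult, Cminus, Cplus, Copp, RtoC; simpl; f_equal; ring. }
    assert (HQ0 : 0 <= Re Q) by (rewrite ER; apply Rmult_le_pos; [lra|apply Hpos, Ha]).
    apply Rle_trans with ((1 - Cmod z ^ 2) * (2 - s) * Cmod (RtoC s * q z + Cconj Q) ^ 2).
    { apply Rmult_le_compat; [apply Rmult_le_pos; lra|apply pow2_ge_0| |].
      - apply Rmult_le_compat_l; lra.
      - apply pow_incr; split; [lra|exact B1]. }
    eapply Rle_trans; [exact P'|].
    apply Rmult_le_compat; [|apply pow2_ge_0| |].
    + apply Rmult_le_pos; lra.
    + apply Rmult_le_compat_l; lra.
    + apply pow_incr; split; [apply Cmod_ge_0|exact B3]. }
assert (L2 : (8 * m) * (m * (1 - Cmod z ^ 2)) <= (8 * m) * (R0 * D ^ 2)).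
{ eapply Rle_trans; [|eapply Rle_trans; [exact L'|]]; right; ring. }
apply Rmult_le_reg_l in L2; lra.
Qed.

Lemma circle_minus_neq_0 (zeta z : C) : on_circle zeta -> in_disk z -> (z - zeta)%C <> RtoC 0.
Proof.
unfold on_circle, in_disk; intros H1 H2 E.
replace zeta with (z - (z - zeta))%C in H1 by ring.
rewrite E in H1; replace (z - 0)%C with z in H1 by ring; lra.
Qed.

Lemma circle_conj (zeta : C) : on_circle zeta -> (zeta * Cconj zeta)%C = RtoC 1.
Proof. unfold on_circle; intros H; rewrite <- Cmod2_conj, H; f_equal; ring. Qed.

(** -(1 - z)^2 / g equals (1 - zeta)(1 - z) / (|d| (z - zeta)), whose real part is (1 - Re zeta)/|d|
    times the Poisson kernel at zeta. Thus Julia's inequality for this mass is an equality on the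
    kernel. *)
Lemma inv_g_Re (zeta z : C) (d : R) : on_circle zeta -> in_disk z ->
  Re (- ((1 - z) * (1 - z)) * inv_g zeta d z) * Cmod (1 - Cconj zeta * z) ^ 2
  = (1 - Re zeta) / Rabs d * (1 - Cmod z ^ 2).
Proof.
intros Hzeta Hz; assert (N1 := one_minus_neq_0 z Hz).
assert (N2 := circle_minus_neq_0 zeta z Hzeta Hz).
assert (N3 : (z - 1)%C <> RtoC 0).
{ intros E; apply N1; replace (1 - z)%C with (- (z - 1))%C by ring; rewrite E; ring. }
assert (Hc := circle_conj zeta Hzeta).
assert (Hm : Cmod (1 - Cconj zeta * z) ^ 2 = Cmod (z - zeta) ^ 2).
{ rewrite <- (Rmult_1_l (Cmod (1 - Cconj zeta * z) ^ 2)).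
  unfold on_circle in Hzeta; rewrite <- (pow1 2), <- Hzeta at 1.
  rewrite <- Rpow_mult_distr, <- Cmod_mult.
  replace (zeta * (1 - Cconj zeta * z))%C with (zeta - (zeta * Cconj zeta) * z)%C by ring.
  rewrite Hc; replace (zeta - 1 * z)%C with (- (z - zeta))%C by ring.
  rewrite Cmod_opp; reflexivity. }
rewrite Hm.
assert (Hm0 : 0 < Cmod (z - zeta) ^ 2) by (apply pow_lt, Cmod_gt_0, N2).
assert (E : (- ((1 - z) * (1 - z)) * inv_g zeta d z)%C =
  (RtoC (/ Rabs d * / Cmod (z - zeta) ^ 2) * ((1 - zeta) * (1 - z) * Cconj (z - zeta)))%C).
{ assert (HDc : Cconj (z - zeta) <> RtoC 0).
  { apply Cmod_gt_0; rewrite Cmod_conj; apply Cmod_gt_0, N2. }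
  rewrite RtoC_mult, (RtoC_inv (Cmod (z - zeta) ^ 2)) by lra.
  rewrite Cmod2_conj; unfold inv_g; field; auto. }
rewrite E.
replace (Re _)
  with (/ Rabs d * / Cmod (z - zeta) ^ 2 * Re ((1 - zeta) * (1 - z) * Cconj (z - zeta)))
  by (unfold Re; simpl; ring).
assert (E2 : Re ((1 - zeta) * (1 - z) * Cconj (z - zeta)) = (1 - Re zeta) * (1 - Cmod z ^ 2)).
{ apply (f_equal Re) in Hc.
  rewrite Cmod2_alt; destruct z as [x y], zeta as [u v]; unfold Re, Im in *; simpl in *.
  assert (H1 : u * u + v * v - 1 = 0) by lra.
  (* Off the circle the two sides differ by (|zeta|^2 - 1)(1 - Re z). *)
  apply Rminus_diag_uniq; transitivity ((u * u + v * v - 1) * (1 - x)); [ring|].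
  rewrite H1; ring. }
rewrite E2; unfold Rdiv; set (k := / Rabs d); field; apply Rgt_not_eq, Cmod_gt_0, N2.
Qed.

Lemma inv_g_cdiff (zeta z : C) (d : R) :
  z <> RtoC 1 -> z <> zeta -> cdiff (inv_g zeta d) z.
Proof.
intros H1 H2.
assert (Hn : forall c : C, z <> c -> (z - c)%C <> RtoC 0).
{ intros c Hc E; apply Hc; replace z with ((z - c) + c)%C by ring; rewrite E; ring. }
apply cdiff_mult; [apply cdiff_const|].
apply cdiff_minus; (apply cdiff_inv; [apply Hn; assumption|]);
  (apply cdiff_minus; [apply cdiff_id|apply cdiff_const]).
Qed.

(** On the radius |r zeta - zeta| = 1 - r, so it lies in the Stolz region of aperture 2. *)
Lemma angular_derivative_radial_lim (f : C -> C) (zeta l : C) :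
  on_circle zeta -> is_angular_derivative f zeta l ->
  radial_lim (fun r => f (RtoC r * zeta) / (RtoC r * zeta - zeta))%C l.
Proof.
intros Hz H eps He; unfold on_circle in Hz.
assert (H12 : 1 < 2) by lra.
destruct (filterlim_C_eps _ _ _ _ _ (H 2 H12) eps He) as [d Hd].
exists (Rmin d 1); split; [apply Rmin_glb_lt; [apply cond_pos|lra]|].
intros r Hr; generalize (Rmin_l d 1) (Rmin_r d 1); intros.
assert (Hm : Cmod (RtoC r * zeta) = r) by (rewrite Cmod_mult, Hz, Cmod_R, Rabs_pos_eq; lra).
assert (Hdist : Cmod (RtoC r * zeta - zeta) = 1 - r).
{ replace (r * zeta - zeta)%C with (RtoC (r - 1) * zeta)%C by (rewrite RtoC_minus; ring).
  rewrite Cmod_mult, Hz, Cmod_R, Rabs_left; lra. }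
apply Hd.
- apply C_NormedModule_mixin_compat1.
  change (Cmod (RtoC r * zeta - zeta) < d); lra.
- split; [unfold in_disk; lra|]. lra.
Qed.

(* [- (1 - zeta)^2 / (zeta f'(zeta)) = 2 (1 - Re zeta) / |f'(zeta)|] since
   [zeta] is on the circle. *)
Lemma reciprocal_radial_lim (f : C -> C) (zeta : C) (d : R) :
  (forall w, in_disk w -> f w <> RtoC 0) ->
  on_circle zeta -> d < 0 -> is_angular_derivative f zeta (RtoC d) ->
  radial_lim (fun r => (1 - RtoC r) *
      (- ((1 - RtoC r * zeta) * (1 - RtoC r * zeta)) * / f (RtoC r * zeta)))%C
    (RtoC (2 * ((1 - Re zeta) / Rabs d))).
Proof.
intros Hf Hz Hd Ha.
assert (Hz0 : zeta <> RtoC 0).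
{ unfold on_circle in Hz; intros E; rewrite E, Cmod_0 in Hz; lra. }
assert (Hd0 : RtoC d <> RtoC 0).
{ apply Cmod_gt_0; rewrite Cmod_R, Rabs_left; lra. }
assert (L1 := radial_lim_comp Cinv _ _ (cdiff_inv_id _ Hd0)
   (angular_derivative_radial_lim f zeta _ Hz Ha)).
(* Since r zeta - zeta = -(1 - r) zeta, the function is the product of (1 - r zeta)^2 / zeta,
   regular at r = 1, and the inverse of the quotient defining the angular derivative. *)
assert (L2 := radial_lim_comp (fun x => (1 - x * zeta) * (1 - x * zeta) * / zeta)%C RtoC (RtoC 1)).
assert (Hc : cdiff (fun x => (1 - x * zeta) * (1 - x * zeta) * / zeta)%C (RtoC 1)).
{ apply cdiff_mult; [|apply cdiff_const].
  apply cdiff_mult; (apply cdiff_minus; [apply cdiff_const|]);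
  (apply cdiff_mult; [apply cdiff_id|apply cdiff_const]). }
assert (L3 := radial_lim_mult _ _ _ _ (L2 Hc radial_lim_id) L1).
cbv beta in L3.
replace (RtoC (2 * ((1 - Re zeta) / Rabs d)))
  with ((1 - 1 * zeta) * (1 - 1 * zeta) * / zeta * / RtoC d)%C.
- revert L3; apply radial_lim_ext; intros r Hr.
  assert (Hw : in_disk (RtoC r * zeta)).
  { unfold in_disk; unfold on_circle in Hz; rewrite Cmod_mult, Hz, Cmod_R, Rabs_pos_eq; lra. }
  assert (N1 := Hf _ Hw); assert (N2 := circle_minus_neq_0 _ _ Hz Hw).
  assert (N3 : (RtoC r - 1)%C <> RtoC 0).
  { apply Cmod_gt_0; rewrite <- RtoC_minus, Cmod_R, Rabs_left; lra. }
  field; auto.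
- assert (Hq : ((1 - 1 * zeta) * (1 - 1 * zeta) * / zeta)%C = RtoC (- 2 * (1 - Re zeta))).
  { assert (Hcj := circle_conj zeta Hz).
    replace (/ zeta)%C with (Cconj zeta).
    2:{ replace (Cconj zeta) with (zeta * Cconj zeta * / zeta)%C by (field; exact Hz0).
        rewrite Hcj; ring. }
    transitivity (Cconj zeta - 2 * (zeta * Cconj zeta) + (zeta * Cconj zeta) * zeta)%C; [ring|].
    rewrite Hcj; destruct zeta; unfold Cconj, Cmult, Cminus, Cplus, Copp, RtoC, Re; simpl.
    f_equal; ring. }
  rewrite Hq, <- RtoC_inv, <- RtoC_mult by lra.
  f_equal; rewrite Rabs_left by lra; field; lra.
Qed.

(** * Removal of the atoms and the final estimate *)

Lemma sum_n_m_Re_Im (u : nat -> C) (N : nat) :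
  Re (sum_n_m u 1 N) = sum_n_m (fun k => Re (u k)) 1 N /\
  Im (sum_n_m u 1 N) = sum_n_m (fun k => Im (u k)) 1 N.
Proof.
induction N as [|N [IHr IHi]].
- rewrite !sum_n_m_zero by lia; split; reflexivity.
- rewrite !sum_n_Sm by lia; rewrite <- IHr, <- IHi; split; reflexivity.
Qed.

Lemma sum_n_m_opp_R (u : nat -> R) (N : nat) :
  sum_n_m (fun k => - u k) 1 N = - sum_n_m u 1 N.
Proof.
induction N as [|N IH].
- rewrite !sum_n_m_zero by lia; change (0 = - 0); ring.
- rewrite !sum_n_Sm by lia; rewrite IH; unfold plus; simpl; ring.
Qed.

Lemma inv_g_0 (zeta : C) (d : R) : on_circle zeta ->
  Re (inv_g zeta d 0) = - ((1 - Re zeta) / Rabs d) /\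
  Im (inv_g zeta d 0) = - (Im zeta / Rabs d).
Proof.
intros Hz; assert (Hc := circle_conj zeta Hz).
assert (Hz0 : zeta <> RtoC 0).
{ unfold on_circle in Hz; intros E; rewrite E, Cmod_0 in Hz; lra. }
replace (inv_g zeta d 0) with (RtoC (/ Rabs d) * (Cconj zeta - 1))%C.
- split; unfold Re, Im; simpl; unfold Rdiv; ring.
- unfold inv_g; f_equal.
  replace (Cconj zeta) with (zeta * Cconj zeta * / zeta)%C by (field; exact Hz0).
  rewrite Hc; field; exact Hz0.
Qed.

Definition reduced_reciprocal (f : C -> C) (zeta : nat -> C) (d : nat -> R) (n : nat) (z : C) : C :=
  (- ((1 - z) * (1 - z)) * (/ f z - sum_n_m (fun k => inv_g (zeta k) (d k) z) 1 n))%C.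

Lemma reduced_reciprocal_S (f : C -> C) (zeta : nat -> C) (d : nat -> R) (n : nat) (z : C) :
  reduced_reciprocal f zeta d (S n) z =
  (reduced_reciprocal f zeta d n z
   + (1 - z) * (1 - z) * inv_g (zeta (S n)) (d (S n)) z)%C.
Proof.
unfold reduced_reciprocal; rewrite sum_n_Sm by lia.
change plus with Cplus; ring.
Qed.

Lemma in_disk_neq_circle (zeta z : C) : on_circle zeta -> in_disk z -> z <> zeta.
Proof. unfold on_circle, in_disk; intros H1 H2 ->; lra. Qed.

Lemma on_circle_1 : on_circle (RtoC 1).
Proof. exact Cmod_1. Qed.

(* Each subtraction removes the point mass at one [zeta k] from the Herglotz
   measure, without changing the mass at the remaining points. *)
Lemma reduced_reciprocal_half_plane (F : R -> C -> C) (f : C -> C)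
  (N : nat) (zeta : nat -> C) (d : nat -> R) :
  is_semigroup F -> is_generator F f -> is_Denjoy_Wolff_point F (RtoC 1) ->
  (forall n : nat, (1 <= n <= N)%nat ->
     boundary_regular_null_point f (zeta n) /\ zeta n <> RtoC 1 /\
     is_angular_derivative f (zeta n) (RtoC (d n)) /\ d n < 0) ->
  (forall m n : nat, (1 <= m <= N)%nat -> (1 <= n <= N)%nat ->
     m <> n -> zeta m <> zeta n) ->
  forall n, (n <= N)%nat ->
  holomorphic_on_disk (reduced_reciprocal f zeta d n) /\
  (forall w, in_disk w -> 0 <= Re (reduced_reciprocal f zeta d n w)) /\
  (forall j, (n < j <= N)%nat ->
     radial_lim (fun r => (1 - RtoC r) * reduced_reciprocal f zeta d n (RtoC r * zeta j))%C
       (RtoC (2 * ((1 - Re (zeta j)) / Rabs (d j))))).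
Proof.
intros HF Hg HDW Hnull Hdist.
assert (Hf0 : forall w, in_disk w -> f w <> RtoC 0)
  by (intros w Hw; apply (generator_neq_0 F f w HF Hg HDW Hw)).
induction n as [|n IH]; intros Hn.
- assert (E0 : forall w, reduced_reciprocal f zeta d 0 w = (- ((1 - w) * (1 - w)) * / f w)%C).
  { intros w; unfold reduced_reciprocal; rewrite sum_n_m_zero by lia.
    change (@zero C_AbelianMonoid) with (RtoC 0); ring. }
  split; [|split].
  + intros w Hw; apply (cdiff_ext (fun w => - ((1 - w) * (1 - w)) * / f w)%C _ w 1); [lra| |].
    * intros x _; symmetry; apply E0.
    * apply cdiff_mult; [apply cdiff_opp, one_minus_sqr_cdiff|].
      apply cdiff_inv; [apply Hf0, Hw|apply (proj1 Hg), Hw].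
  + intros w Hw; rewrite E0.
    assert (B := berkson_porta_sign F f HF HDW Hg w Hw).
    assert (Hm : 0 < Cmod (f w) ^ 2) by (apply pow_lt, Cmod_gt_0, Hf0, Hw).
    assert (HDc : Cconj (f w) <> RtoC 0).
    { apply Cmod_gt_0; rewrite Cmod_conj; apply Cmod_gt_0, Hf0, Hw. }
    replace (- ((1 - w) * (1 - w)) * / f w)%C
      with (RtoC (/ Cmod (f w) ^ 2) * - ((1 - w) * (1 - w) * Cconj (f w)))%C.
    * replace (Re (_ * _)) with (/ Cmod (f w) ^ 2 * - Re (f w * Cconj ((1 - w) * (1 - w))))
        by (unfold Re; simpl; ring).
      apply Rmult_le_pos; [left; apply Rinv_0_lt_compat, Hm|lra].
    * rewrite RtoC_inv by lra; rewrite Cmod2_conj; field; auto.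
  + intros j Hj; destruct (Hnull j ltac:(lia)) as [[Hc _] [_ [Ha Hd]]].
    generalize (reciprocal_radial_lim f (zeta j) (d j) Hf0 Hc Hd Ha).
    apply radial_lim_ext; intros r _; rewrite E0; reflexivity.
- destruct (IH ltac:(lia)) as [Hh [Hre Hrad]]; clear IH.
  destruct (Hnull (S n) ltac:(lia)) as [[Hc _] [H1 [Ha Hd]]].
  (* The mass is strictly positive because 1 is the only point of the circle with real part 1. *)
  assert (Hm : 0 < (1 - Re (zeta (S n))) / Rabs (d (S n))).
  { apply Rdiv_lt_0_compat; [|apply Rabs_pos_lt; lra].
    assert (Hle := re_le_Cmod (zeta (S n))); unfold on_circle in Hc.
    rewrite Hc in Hle; apply Rabs_le_between in Hle.
    destruct (proj2 Hle) as [Hlt|E]; [lra|exfalso; apply H1].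
    assert (Hq := Cmod2_alt (zeta (S n))); rewrite Hc, E in Hq.
    destruct (zeta (S n)) as [x y]; unfold Re, Im, RtoC in *; simpl in *.
    f_equal; [exact E|nra]. }
  assert (Hterm : forall w, w <> RtoC 1 -> w <> zeta (S n) ->
    cdiff (fun w => (1 - w) * (1 - w) * inv_g (zeta (S n)) (d (S n)) w)%C w).
  { intros w Hw1 Hw2; apply cdiff_mult; [apply one_minus_sqr_cdiff|].
    apply inv_g_cdiff; assumption. }
  split; [|split].
  + intros w Hw.
    apply (cdiff_ext (fun w => reduced_reciprocal f zeta d n w
      + (1 - w) * (1 - w) * inv_g (zeta (S n)) (d (S n)) w)%C _ w 1); [lra| |].
    * intros x _; symmetry; apply reduced_reciprocal_S.
    * apply cdiff_plus; [apply Hh, Hw|].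
      apply Hterm; apply in_disk_neq_circle; auto; apply on_circle_1.
  + intros w Hw; rewrite reduced_reciprocal_S.
    (* By [inv_g_Re] the lower bound from Julia's lemma is exactly the real part about to be
       subtracted, so nonnegativity is preserved. *)
    assert (J := julia_boundary _ (zeta (S n)) w _ Hh Hre Hc Hm (Hrad (S n) ltac:(lia)) Hw).
    rewrite <- inv_g_Re in J by assumption.
    assert (HP : 0 < Cmod (1 - Cconj (zeta (S n)) * w) ^ 2).
    { apply pow_lt, Cmod_gt_0; intros E.
      apply (circle_minus_neq_0 _ _ Hc Hw).
      replace (w - zeta (S n))%C with
        (- zeta (S n) * (1 - Cconj (zeta (S n)) * w) - w * (zeta (S n) * Cconj (zeta (S n)) - 1))%C
        by ring.
      rewrite E, circle_conj by exact Hc; ring. }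
    apply Rmult_le_reg_r in J; [|exact HP].
    revert J; unfold Re; simpl; lra.
  + intros j Hj.
    destruct (Hnull j ltac:(lia)) as [_ [Hj1 _]].
    (* The new term is differentiable at zeta j, which differs from 1 and from zeta (S n), so the
       factor 1 - r sends its contribution to 0. *)
    assert (L := radial_lim_comp (fun x => (1 - x) * ((1 - x * zeta j) * (1 - x * zeta j)
       * inv_g (zeta (S n)) (d (S n)) (x * zeta j)))%C RtoC (RtoC 1)).
    assert (Hcd : cdiff (fun x => (1 - x) * ((1 - x * zeta j) * (1 - x * zeta j)
       * inv_g (zeta (S n)) (d (S n)) (x * zeta j)))%C (RtoC 1)).
    { apply cdiff_mult; [apply cdiff_minus; [apply cdiff_const|apply cdiff_id]|].
      apply (cdiff_comp (fun w => (1 - w) * (1 - w) * inv_g (zeta (S n)) (d (S n)) w)%C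
        (fun x => x * zeta j)%C).
      - rewrite Cmult_1_l; apply Hterm; [exact Hj1|apply Hdist; lia].
      - apply cdiff_mult; [apply cdiff_id|apply cdiff_const]. }
    assert (L' := radial_lim_plus _ _ _ _ (Hrad j ltac:(lia)) (L Hcd radial_lim_id)).
    cbv beta in L'.
    match type of L' with radial_lim _ ?x =>
      replace x with (RtoC (2 * ((1 - Re (zeta j)) / Rabs (d j)))) in L' by ring end.
    revert L'; apply radial_lim_ext; intros r _; rewrite reduced_reciprocal_S; ring.
Qed.

(** Pick's inequality at 0 reads |k - A| <= |z| |k + A| with A = Re h(0) and k = h(z) - i Im h(0).
    Both bounds then follow from the triangle inequality. *)
Lemma half_plane_harnack (h : C -> C) (z : C) :
  holomorphic_on_disk h -> (forall w, in_disk w -> 0 <= Re (h w)) -> in_disk z ->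
  Re (h (RtoC 0)) * ((1 - Cmod z) / (1 + Cmod z)) <= Cmod (h z - Ci * RtoC (Im (h (RtoC 0))))
  <= Re (h (RtoC 0)) * ((1 + Cmod z) / (1 - Cmod z)).
Proof.
intros Hh Hpos Hz.
assert (H := half_plane_pick h (RtoC 0) z Hh Hpos in_disk_0 Hz).
assert (HA := Hpos _ in_disk_0).
set (A := Re (h (RtoC 0))) in *; set (k := (h z - Ci * RtoC (Im (h (RtoC 0))))%C).
replace (h z - h 0)%C with (k - RtoC A)%C in H.
2:{ unfold k, A; destruct (h z), (h (RtoC 0)).
    unfold Ci, Re, Im, Cmult, Cminus, Cplus, Copp, RtoC; simpl; f_equal; ring. }
replace (h z + Cconj (h 0))%C with (k + RtoC A)%C in H.
2:{ unfold k, A; destruct (h z), (h (RtoC 0)).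
    unfold Ci, Re, Im, Cconj, Cmult, Cminus, Cplus, Copp, RtoC; simpl; f_equal; ring. }
replace (1 - Cconj 0 * z)%C with (RtoC 1) in H
  by (destruct z; unfold Cconj, Cmult, Cminus, Cplus, Copp, RtoC; simpl; f_equal; ring).
replace (z - 0)%C with z in H by ring.
rewrite Cmod_1, Rmult_1_r in H.
unfold in_disk in Hz; assert (Hz0 := Cmod_ge_0 z); assert (Hk := Cmod_ge_0 k).
assert (T1 := Cmod_triangle k (RtoC A)).
assert (T2 := Cmod_triangle (k - RtoC A) (RtoC A)).
replace (k - RtoC A + RtoC A)%C with k in T2 by ring.
assert (T3 := Cmod_triangle k (- (k - RtoC A))).
replace (k + - (k - RtoC A))%C with (RtoC A) in T3 by ring.
rewrite Cmod_opp in T3.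
rewrite !Cmod_R, !(Rabs_pos_eq A) in * by lra.
set (x := Cmod z) in *; set (y := Cmod k) in *.
assert (B : Cmod (k - RtoC A) <= x * (y + A)).
{ eapply Rle_trans; [exact H|apply Rmult_le_compat_l; assumption]. }
split.
- apply (Rmult_le_reg_r (1 + x)); [lra|].
  replace (A * ((1 - x) / (1 + x)) * (1 + x)) with (A * (1 - x)) by (field; lra). nra.
- apply (Rmult_le_reg_r (1 - x)); [lra|].
  replace (A * ((1 + x) / (1 - x)) * (1 - x)) with (A * (1 + x)) by (field; lra). nra.
Qed.

Theorem theorem6p1 :
  forall (F : R -> C -> C) (f : C -> C),
  is_semigroup F ->
  is_generator F f ->
  is_Denjoy_Wolff_point F (RtoC 1) ->
  forall (N : nat) (zeta : nat -> C) (d : nat -> R),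
  (forall n : nat, (1 <= n <= N)%nat ->
     boundary_regular_null_point f (zeta n) /\
     zeta n <> RtoC 1 /\
     is_angular_derivative f (zeta n) (RtoC (d n)) /\
     d n < 0) ->
  (forall m n : nat, (1 <= m <= N)%nat -> (1 <= n <= N)%nat ->
     m <> n -> zeta m <> zeta n) ->
  forall z : C, in_disk z ->
  const_C f N zeta d * lower_l z
    <= Cmod (/ f z
             - sum_n_m (fun n => inv_g (zeta n) (d n) z) 1 N
             - Ci * RtoC (const_c f N zeta d) / ((z - 1) * (z - 1)))%C
    <= const_C f N zeta d * upper_u z.
Proof.
intros F f HF Hg HDW N zeta d Hnull Hdist z Hz.
destruct (reduced_reciprocal_half_plane F f N zeta d HF Hg HDW Hnull Hdist N (Nat.le_refl N))
  as [Hh [Hre _]].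
set (h := reduced_reciprocal f zeta d N) in *.
assert (E0 : h (RtoC 0) = (sum_n_m (fun k => inv_g (zeta k) (d k) 0) 1 N - / f (RtoC 0))%C)
  by (unfold h, reduced_reciprocal; ring).
destruct (sum_n_m_Re_Im (fun k => inv_g (zeta k) (d k) 0) N) as [SR SI].
assert (Hcirc : forall k, (1 <= k <= N)%nat -> on_circle (zeta k))
  by (intros k Hk; apply (Hnull k Hk)).
assert (ER : Re (h (RtoC 0)) = const_C f N zeta d).
{ rewrite E0; unfold const_C.
  transitivity (Re (sum_n_m (fun k => inv_g (zeta k) (d k) 0) 1 N) - Re (/ f (RtoC 0))%C).
  { unfold Re; simpl; ring. }
  rewrite SR, (sum_n_m_ext_loc _ (fun k => - ((1 - Re (zeta k)) / Rabs (d k)))).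
  - rewrite sum_n_m_opp_R; ring.
  - intros k Hk; apply inv_g_0, Hcirc, Hk. }
assert (EI : Im (h (RtoC 0)) = - const_c f N zeta d).
{ rewrite E0; unfold const_c.
  transitivity (Im (sum_n_m (fun k => inv_g (zeta k) (d k) 0) 1 N) - Im (/ f (RtoC 0))%C).
  { unfold Im; simpl; ring. }
  rewrite SI, (sum_n_m_ext_loc _ (fun k => - (Im (zeta k) / Rabs (d k)))).
  - rewrite sum_n_m_opp_R; ring.
  - intros k Hk; apply inv_g_0, Hcirc, Hk. }
assert (H := half_plane_harnack h z Hh Hre Hz).
rewrite ER, EI in H.
assert (N1 := one_minus_neq_0 z Hz).
assert (N2 : (z - 1)%C <> RtoC 0)
  by (apply (circle_minus_neq_0 (RtoC 1)); [apply on_circle_1|exact Hz]).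
assert (N3 := generator_neq_0 F f z HF Hg HDW Hz).
set (c := const_c f N zeta d) in *; set (K := const_C f N zeta d) in *.
(* As Im h(0) = -c, the quantity bounded by Harnack is h(z) + ic; dividing it by -(1 - z)^2 restores
   the expression of the theorem. *)
replace (/ f z - sum_n_m (fun n => inv_g (zeta n) (d n) z) 1 N
         - Ci * RtoC c / ((z - 1) * (z - 1)))%C
  with (- ((h z - Ci * RtoC (- c)) / ((1 - z) * (1 - z))))%C.
2:{ unfold h, reduced_reciprocal; rewrite RtoC_opp; field; auto. }
rewrite Cmod_opp, Cmod_div, Cmod_mult by (apply Cmult_neq_0; exact N1).
unfold lower_l, upper_u.
assert (Hp : 0 < Cmod (1 - z)) by (apply Cmod_gt_0, N1).
assert (Hi : 0 <= 1 / Cmod (1 - z) ^ 2)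
  by (apply Rdiv_le_0_compat; [lra|apply pow_lt, Hp]).
replace (Cmod (h z - Ci * RtoC (- c)) / (Cmod (1 - z) * Cmod (1 - z)))
  with (Cmod (h z - Ci * RtoC (- c)) * (1 / Cmod (1 - z) ^ 2)) by (field; lra).
rewrite <- !Rmult_assoc.
split; apply Rmult_le_compat_r; try exact Hi; apply H.
Qed.
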